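(* A decomposable $7$-dimensional real nilpotent Lie algebra (i.e. one that is a direct sum of two nonzero ideals) admits a calibrated $\mathrm{G}_2$-structure if and only if it is isomorphic to one of $(0,0,0,0,0,0,0)$, $(0,0,0,0,12,13,0)$, $(0,0,0,12,13,23,0)$.
   Context: Notation: $(a_1,\dots,a_n)$ denotes the Lie algebra having a basis $e^1,\dots,e^n$ of its dual with $de^i=a_i$, where e.g. ''$12$'' stands for $e^{12}=e^1\wedge e^2$; $d$ is the Chevalley–Eilenberg differential. A $3$-form $\varphi\in\Lambda^3\mathfrak g^*$ on a $7$-dimensional Lie algebra defines a $\mathrm{G}_2$-structure if there is a basis $f^1,\dots,f^7$ of $\mathfrak g^*$ with $\varphi=f^{127}+f^{347}+f^{567}+f^{135}-f^{236}-f^{146}-f^{245}$ (where $f^{ijk}=f^i\wedge f^j\wedge f^k$); the $\mathrm{G}_2$-structure is calibrated if $d\varphi=0$. *)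

(* Defs.v *)
(* Real Lie algebras of dimension 7 are modelled as R^7 (row
   vectors 'rV[R]_7) with a bracket given by structure constants; R is an
   arbitrary real closed field. *)
From HB Require Import structures.
From mathcomp Require Import all_boot all_order all_algebra.
Set Implicit Arguments. Unset Strict Implicit. Unset Printing Implicit Defensive.
Import Order.TTheory GRing.Theory Num.Theory.
Local Open Scope ring_scope.

(* structure constants: [e_i, e_j] = \sum_k c i j k e_k *)
Definition sconst (R : Type) := 'I_7 -> 'I_7 -> 'I_7 -> R.

Definition lbr (R : comNzRingType) (c : sconst R) (x y : 'rV[R]_7) : 'rV[R]_7 :=
  \sum_(i < 7) \sum_(j < 7) (x 0 i * y 0 j) *: \row_k c i j k.

(* the bracket is a Lie bracket: alternating and Jacobi (bilinear by construction) *)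
Definition is_lie (R : comNzRingType) (c : sconst R) : Prop :=
  (forall x, lbr c x x = 0) /\
  (forall x y z, lbr c x (lbr c y z) + lbr c y (lbr c z x) + lbr c z (lbr c x y) = 0).

(* nilpotent: the lower central series reaches 0, i.e. for some n every
   left-normed bracket [x_1,[x_2,...,[x_n,y]...]] vanishes *)
Definition lie_nilpotent (R : comNzRingType) (c : sconst R) : Prop :=
  exists n : nat, forall (s : seq 'rV[R]_7) (y : 'rV[R]_7),
    size s = n -> foldr (lbr c) y s = 0.

Definition lie_ideal (F : fieldType) (c : sconst F) (A : 'M[F]_7) : Prop :=
  forall x y : 'rV[F]_7, (x <= A)%MS -> (lbr c x y <= A)%MS.

Definition lie_decomposable (F : fieldType) (c : sconst F) : Prop :=
  exists A B : 'M[F]_7,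
    [/\ lie_ideal c A, lie_ideal c B, A != 0 /\ B != 0,
        (A :&: B == (0 : 'M[F]_7))%MS & (A + B == 1%:M)%MS].

Definition lie_iso (F : fieldType) (c c' : sconst F) : Prop :=
  exists L : 'M[F]_7, L \in unitmx /\
    forall x y, lbr c' (x *m L) (y *m L) = lbr c x y *m L.

(* covectors f^a(x) = (x *m P) 0 a, P invertible <=> (f^a) is a basis of g^* *)
Definition cov (R : comNzRingType) (P : 'M[R]_7) (a : 'I_7) (x : 'rV[R]_7) : R :=
  (x *m P) 0 a.

(* f^a /\ f^b /\ f^c evaluated on (u,v,w) (determinant convention) *)
Definition wedge3 (R : comNzRingType) (P : 'M[R]_7) (a b d : 'I_7)
    (u v w : 'rV[R]_7) : R :=
  let fa := cov P a in let fb := cov P b in let fd := cov P d in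
    fa u * (fb v * fd w - fb w * fd v)
  - fa v * (fb u * fd w - fb w * fd u)
  + fa w * (fb u * fd v - fb v * fd u).

Definition o7 (n : nat) : 'I_7 := inord n.

Definition phiG2 (R : comNzRingType) (P : 'M[R]_7) (u v w : 'rV[R]_7) : R :=
    wedge3 P (o7 0) (o7 1) (o7 6) u v w + wedge3 P (o7 2) (o7 3) (o7 6) u v w
  + wedge3 P (o7 4) (o7 5) (o7 6) u v w + wedge3 P (o7 0) (o7 2) (o7 4) u v w
  - wedge3 P (o7 1) (o7 2) (o7 5) u v w - wedge3 P (o7 0) (o7 3) (o7 5) u v w
  - wedge3 P (o7 1) (o7 3) (o7 4) u v w.

(* Chevalley-Eilenberg differential of a 3-form (alternating trilinear map) *)
Definition d3 (R : comNzRingType) (c : sconst R)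
    (phi : 'rV[R]_7 -> 'rV[R]_7 -> 'rV[R]_7 -> R) (x0 x1 x2 x3 : 'rV[R]_7) : R :=
    phi (lbr c x0 x1) x2 x3 - phi (lbr c x0 x2) x1 x3 + phi (lbr c x0 x3) x1 x2
  + phi (lbr c x1 x2) x0 x3 - phi (lbr c x1 x3) x0 x2 + phi (lbr c x2 x3) x0 x1.

(* g_c admits a calibrated G2-structure: some phi defining a G2-structure
   (i.e. of the standard form in some basis f^1..f^7 of g^* ) is closed *)
Definition has_calibrated_G2 (F : fieldType) (c : sconst F) : Prop :=
  exists P : 'M[F]_7, P \in unitmx /\
    forall x0 x1 x2 x3, d3 c (phiG2 P) x0 x1 x2 x3 = 0.

(* Lie algebra from the notation (a_1,...,a_7): list of triples (a,b,k)
   (0-based, a<b) meaning d e^k = e^{ab}.  With de(x,y) = - e([x,y]) this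
   means [e_a,e_b] = - e_k. *)
Definition mk_sc (R : ringType) (l : seq (nat * nat * nat)) : sconst R :=
  fun i j k => \sum_(t <- l)
    ((nat_of_bool [&& (i : nat) == t.1.2, (j : nat) == t.1.1 & (k : nat) == t.2])%:R
   - (nat_of_bool [&& (i : nat) == t.1.1, (j : nat) == t.1.2 & (k : nat) == t.2])%:R).

Definition lie_ab (R : ringType) : sconst R := mk_sc R [::].
Definition lie_n1 (R : ringType) : sconst R := mk_sc R [:: (0,1,4); (0,2,5)]%N.
Definition lie_n2 (R : ringType) : sconst R :=
  mk_sc R [:: (0,1,3); (0,2,4); (1,2,5)]%N.

(* Main.v *)
(* If both ideals were non-abelian, each would contain a non-zero bracket which is
   central in g, say W = [x1, y1] and S = [x2, y2]; d phi = 0 then gives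
   phi(W, S, _) = 0, which for a G2-form forces W and S to be proportional.  So
   one ideal is abelian, and g has a central vector e outside [g, g].

   Let W be a non-zero central bracket and v a bracket which is central modulo W.
   The stabiliser of the form is transitive enough to provide a basis adapted to phi,
   numbered from 0 to 6, in which W and e become (up to scalars and multiples of W)
   the vectors 6 and 0, and v lies in the span of the vectors 0, 1, 3, 6.  In this
   basis d phi = 0, the Jacobi identity and nilpotency show that the vectors 3, 4, 6
   (corrected by multiples of e) span a central subspace containing all brackets, so
   the bracket is given by a 3 x 3 matrix M : Lambda^2 R^3 -> R^3.  The remaining
   equations say that tr M = 0 and that M - M^T is determined by M mu for some vector
   mu; they exclude rank 1.  Up to isomorphism the algebra only depends on the rank
   of M, and ranks 2 and 3 are the two non-abelian algebras of the list.

   Conversely, the algebra of the matrix diag(a, b, - a - b) is calibrated, and such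
   matrices realise the ranks 0, 2 and 3. *)
Require Import Defs.
From HB Require Import structures.
From mathcomp Require Import all_boot all_order all_algebra.
From mathcomp Require Import ring lra.
From Stdlib Require Import Classical.
Import Order.TTheory GRing.Theory Num.Theory.
Local Open Scope ring_scope.

Set Implicit Arguments.
Unset Strict Implicit.

Local Notation "x `[ k ]" := (x 0 (o7 k)) (at level 2, k at level 99, format "x `[ k ]").

(** * Coordinates in dimension 7 *)

Lemma o7_eq (a b : nat) : (a < 7)%N -> (b < 7)%N -> (o7 a == o7 b) = (a == b).
Proof. by move=> ha hb; rewrite -val_eqE /= !inordK. Qed.

Lemma val_o7 (i : 'I_7) : o7 i = i.
Proof. exact: inord_val. Qed.

Lemma big_o7 (V : nmodType) (F : 'I_7 -> V) :
  \sum_i F i = F (o7 0) + F (o7 1) + F (o7 2) + F (o7 3) + F (o7 4)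
             + F (o7 5) + F (o7 6).
Proof.
rewrite !big_ord_recl big_ord0 addr0 !addrA.
by repeat congr (_ + _); congr F; apply/val_inj; rewrite /= inordK.
Qed.

Lemma o7_ind (P : 'I_7 -> Prop) :
  P (o7 0) -> P (o7 1) -> P (o7 2) -> P (o7 3) -> P (o7 4) -> P (o7 5) ->
  P (o7 6) -> forall i, P i.
Proof. by move=> ? ? ? ? ? ? ? i; rewrite -(val_o7 i); case: i; do 7?[case=> //]. Qed.

Lemma unitmx_ker (F : fieldType) (n : nat) (M : 'M[F]_n) :
  (forall x : 'rV_n, x *m M = 0 -> x = 0) -> M \in unitmx.
Proof.
move=> h; rewrite -row_free_unit -kermx_eq0; apply/eqP/row_matrixP => i.
by rewrite row0; apply: h; rewrite -row_mul mulmx_ker row0.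
Qed.

(** * The bracket of structure constants *)

Section Bracket.
Variable (R : comNzRingType).
Implicit Types (c : sconst R) (x y z : 'rV[R]_7).

Lemma lbrE c x y k :
  lbr c x y 0 k = \sum_i \sum_j x 0 i * y 0 j * c i j k.
Proof.
rewrite summxE; apply: eq_bigr => i _; rewrite summxE.
by apply: eq_bigr => j _; rewrite !mxE.
Qed.

Lemma lbr_delta c i j : lbr c (delta_mx 0 i) (delta_mx 0 j) = \row_k c i j k.
Proof.
apply/rowP=> k; rewrite lbrE mxE (bigD1 i) //= (bigD1 j) //= !mxE !eqxx !mul1r.
rewrite big1 => [|l /negPf ne]; last by rewrite !mxE ne ?(mulr0, mul0r).
rewrite big1 ?addr0 // => l /negPf ne.
by rewrite big1 // => m _; rewrite !mxE ne ?(mulr0, mul0r).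
Qed.

Lemma lbr_linearl c y : linear (lbr c ^~ y).
Proof.
move=> a x x'; apply/rowP=> k; rewrite !mxE !lbrE mulr_sumr -big_split /=.
apply: eq_bigr => i _; rewrite mulr_sumr -big_split /=.
by apply: eq_bigr => j _; rewrite !mxE; ring.
Qed.

Lemma lbr_linearr c x : linear (lbr c x).
Proof.
move=> a y y'; apply/rowP=> k; rewrite !mxE !lbrE mulr_sumr -big_split /=.
apply: eq_bigr => i _; rewrite mulr_sumr -big_split /=.
by apply: eq_bigr => j _; rewrite !mxE; ring.
Qed.

Lemma lbr0r c x : lbr c x 0 = 0.
Proof. by have := lbr_linearr c x (-1) 0 0; rewrite scaler0 addr0 scaleN1r addNr. Qed.

Lemma lbr0l c x : lbr c 0 x = 0.
Proof. by have := lbr_linearl c x (-1) 0 0; rewrite scaler0 addr0 scaleN1r addNr. Qed.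

Lemma lbrDl c x y z : lbr c (x + y) z = lbr c x z + lbr c y z.
Proof. by have := lbr_linearl c z 1 x y; rewrite !scale1r. Qed.

Lemma lbrDr c x y z : lbr c z (x + y) = lbr c z x + lbr c z y.
Proof. by have := lbr_linearr c z 1 x y; rewrite !scale1r. Qed.

Lemma lbrZl c a x z : lbr c (a *: x) z = a *: lbr c x z.
Proof. by have := lbr_linearl c z a x 0; rewrite lbr0l !addr0. Qed.

Lemma lbrZr c a x z : lbr c z (a *: x) = a *: lbr c z x.
Proof. by have := lbr_linearr c z a x 0; rewrite lbr0r !addr0. Qed.

Lemma lbrC c : is_lie c -> forall x y, lbr c x y = - lbr c y x.
Proof.
case=> alt _ x y; apply/eqP; rewrite -subr_eq0 opprK; apply/eqP.
by have := alt (x + y); rewrite lbrDl !lbrDr !alt addr0 add0r.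
Qed.

Definition sc_of (br : 'rV[R]_7 -> 'rV[R]_7 -> 'rV[R]_7) : sconst R :=
  fun i j k => br (delta_mx 0 i) (delta_mx 0 j) 0 k.

Lemma lbr_sc_of br : (forall y, linear (br ^~ y)) -> (forall x, linear (br x)) ->
  forall x y, lbr (sc_of br) x y = br x y.
Proof.
move=> ll lr x y.
pose fl y : {linear 'rV[R]_7 -> 'rV[R]_7} :=
  HB.pack (br^~ y) (GRing.isLinear.Build R _ _ *:%R _ (ll y)).
pose fr x : {linear 'rV[R]_7 -> 'rV[R]_7} :=
  HB.pack (br x) (GRing.isLinear.Build R _ _ *:%R _ (lr x)).
rewrite [in RHS](row_sum_delta x) -[LHS]/(lbr _ x y).
rewrite -[RHS]/(fl y _) linear_sum; apply: eq_bigr => i _.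
rewrite linearZ /= -[br _ _]/(fr _ y) [in RHS](row_sum_delta y) linear_sum scaler_sumr.
apply: eq_bigr => j _; rewrite linearZ /= scalerA; congr (_ *: _).
by apply/rowP=> k; rewrite !mxE.
Qed.

End Bracket.

(** * Change of basis and invariance under isomorphism *)

Section Transport.
Variable (F : fieldType).
Implicit Types (c : sconst F) (x y z : 'rV[F]_7) (L P : 'M[F]_7).

Lemma phiG2M L P x y z :
  phiG2 (L *m P) x y z = phiG2 P (x *m L) (y *m L) (z *m L).
Proof. by rewrite /phiG2 /wedge3 /cov !mulmxA. Qed.

(** The bracket read in the coordinates [x *m P], in which [phiG2 P] becomes the standard form. *)
Definition transport c P : sconst F :=
  sc_of (fun x y => lbr c (x *m invmx P) (y *m invmx P) *m P).

Lemma lbr_transport c P x y : P \in unitmx ->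
  lbr (transport c P) (x *m P) (y *m P) = lbr c x y *m P.
Proof.
move=> uP; rewrite lbr_sc_of ?mulmxK // => [v a u u' | u a v v'].
- by rewrite mulmxDl -scalemxAl lbr_linearl mulmxDl -scalemxAl.
- by rewrite mulmxDl -scalemxAl lbr_linearr mulmxDl -scalemxAl.
Qed.

Lemma lie_iso_transport c P : P \in unitmx -> lie_iso c (transport c P).
Proof. by move=> uP; exists P; split=> // x y; rewrite lbr_transport. Qed.

Lemma lie_iso_sym c c' : lie_iso c c' -> lie_iso c' c.
Proof.
case=> L [uL h]; exists (invmx L); rewrite unitmx_inv; split=> // x y.
by rewrite -[in RHS](mulmxKV uL x) -[in RHS](mulmxKV uL y) h mulmxK.
Qed.

Lemma lie_iso_trans c c' c'' : lie_iso c c' -> lie_iso c' c'' -> lie_iso c c''.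
Proof.
case=> L [uL h] [L' [uL' h']]; exists (L *m L'); rewrite unitmx_mul uL; split=> // x y.
by rewrite !mulmxA h' h.
Qed.

Lemma lie_iso_is_lie c c' : lie_iso c c' -> is_lie c -> is_lie c'.
Proof.
case=> L [uL h] [alt jac]; split=> [x | x y z].
  by rewrite -(mulmxKV uL x) h alt mul0mx.
rewrite -(mulmxKV uL x) -(mulmxKV uL y) -(mulmxKV uL z) !h -!mulmxDl.
by rewrite jac mul0mx.
Qed.

Lemma lie_iso_nilpotent c c' : lie_iso c c' -> lie_nilpotent c -> lie_nilpotent c'.
Proof.
case=> L [uL h] [n nil]; exists n => s y sz.
suff -> : foldr (lbr c') y s =
    foldr (lbr c) (y *m invmx L) (map (mulmx^~ (invmx L)) s) *m L.
  by rewrite nil ?size_map // mul0mx.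
elim: s {sz} => [|x s IH] /=; first by rewrite mulmxKV.
by rewrite IH -{1}(mulmxKV uL x) h.
Qed.

Lemma d3M c c' L P : (forall x y, lbr c' (x *m L) (y *m L) = lbr c x y *m L) ->
  forall x0 x1 x2 x3, d3 c (phiG2 (L *m P)) x0 x1 x2 x3 =
    d3 c' (phiG2 P) (x0 *m L) (x1 *m L) (x2 *m L) (x3 *m L).
Proof. by move=> h x0 x1 x2 x3; rewrite /d3 !h !phiG2M. Qed.

Lemma lie_iso_calibrated c c' :
  lie_iso c c' -> has_calibrated_G2 c' -> has_calibrated_G2 c.
Proof.
case=> L [uL h] [P [uP cl]]; exists (L *m P); rewrite unitmx_mul uL; split=> // *.
by rewrite (d3M _ h).
Qed.

End Transport.

(** * The standard G2-form and its stabiliser *)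

Section StandardForm.
Variable (R : comNzRingType).
Implicit Types (x y z : 'rV[R]_7).

Definition det3 (a b d : nat) x y z : R :=
  x`[a] * (y`[b] * z`[d] - z`[b] * y`[d])
  - y`[a] * (x`[b] * z`[d] - z`[b] * x`[d])
  + z`[a] * (x`[b] * y`[d] - y`[b] * x`[d]).

Definition phi0 x y z : R :=
  det3 0 1 6 x y z + det3 2 3 6 x y z + det3 4 5 6 x y z + det3 0 2 4 x y z
  - det3 1 2 5 x y z - det3 0 3 5 x y z - det3 1 3 4 x y z.

Lemma phiG2E (P : 'M[R]_7) x y z :
  phiG2 P x y z = phi0 (x *m P) (y *m P) (z *m P).
Proof. by []. Qed.

End StandardForm.

Local Notation dl k := (delta_mx (0 : 'I_1) (o7 k)).

Lemma dlE (R : nzRingType) (a b : nat) : (a < 7)%N -> (b < 7)%N ->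
  (dl a : 'rV[R]_7)`[b] = (a == b)%:R.
Proof. by move=> ha hb; rewrite mxE eqxx o7_eq //= eq_sym. Qed.

Lemma rV7P (R : Type) (x y : 'rV[R]_7) :
  x`[0] = y`[0] -> x`[1] = y`[1] -> x`[2] = y`[2] -> x`[3] = y`[3] ->
  x`[4] = y`[4] -> x`[5] = y`[5] -> x`[6] = y`[6] -> x = y.
Proof. by move=> ? ? ? ? ? ? ?; apply/rowP; apply: o7_ind. Qed.

(** Any coordinate of [x] is a value of [phi0 x] on the two basis vectors that complete its index to
    a line of the Fano plane, taken in the order that gives the sign plus. *)
Lemma phi0_inj (R : comNzRingType) (x : 'rV[R]_7) :
  (forall y z, phi0 x y z = 0) -> x = 0.
Proof.
move=> h.
have e k l : (k < 7)%N -> (l < 7)%N -> phi0 x (dl k) (dl l) = 0 by [].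
apply: rV7P; rewrite mxE.
- by rewrite -(e 1 6)%N // /phi0 /det3 !dlE //=; ring.
- by rewrite -(e 6 0)%N // /phi0 /det3 !dlE //=; ring.
- by rewrite -(e 3 6)%N // /phi0 /det3 !dlE //=; ring.
- by rewrite -(e 6 2)%N // /phi0 /det3 !dlE //=; ring.
- by rewrite -(e 5 6)%N // /phi0 /det3 !dlE //=; ring.
- by rewrite -(e 6 4)%N // /phi0 /det3 !dlE //=; ring.
- by rewrite -(e 0 1)%N // /phi0 /det3 !dlE //=; ring.
Qed.

Lemma phi0_stab_unit (F : fieldType) (M : 'M[F]_7) :
  (forall x y z, phi0 (x *m M) (y *m M) (z *m M) = phi0 x y z) -> M \in unitmx.
Proof.
move=> h; apply: unitmx_ker => x xM0; apply: phi0_inj => y z.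
by rewrite -h xM0 /phi0 /det3 !mxE; ring.
Qed.

(** Column k is the covector giving the new coordinate k. Missing trailing entries are read as 0. *)
Definition mx7 (R : nzRingType) (s : seq (seq R)) : 'M[R]_7 :=
  \matrix_(i, j) nth 0 (nth [::] s j) i.

(* [s] lists the columns. *)
Lemma mul_mx7 (R : comNzRingType) (s : seq (seq R)) (x : 'rV[R]_7) k : (k < 7)%N ->
  (x *m mx7 s)`[k] =
    let r := nth [::] s k in
    x`[0] * nth 0 r 0 + x`[1] * nth 0 r 1 + x`[2] * nth 0 r 2 + x`[3] * nth 0 r 3
    + x`[4] * nth 0 r 4 + x`[5] * nth 0 r 5 + x`[6] * nth 0 r 6.
Proof. by move=> hk; rewrite mxE big_o7 !mxE !inordK. Qed.

Lemma row_sum_dl (R : comNzRingType) (x : 'rV[R]_7) :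
  x = x`[0] *: dl 0 + x`[1] *: dl 1 + x`[2] *: dl 2 + x`[3] *: dl 3
    + x`[4] *: dl 4 + x`[5] *: dl 5 + x`[6] *: dl 6.
Proof. by rewrite [LHS]row_sum_delta big_o7. Qed.

Lemma eq_dl6 (R : nzRingType) (x : 'rV[R]_7) :
  (forall k, (k < 6)%N -> x`[k] = 0) -> x = x`[6] *: dl 6.
Proof. by move=> h; apply: rV7P; rewrite mxE dlE // ?mulr1 // mulr0; exact: h. Qed.

(** * Transitivity of the stabiliser of the standard form *)

Section Rotations.
Variable (R : rcfType).
Implicit Types (x y z : 'rV[R]_7) (M : 'M[R]_7).

Definition stab M := forall x y z, phi0 (x *m M) (y *m M) (z *m M) = phi0 x y z.

Lemma stab1 : stab 1%:M. Proof. by move=> x y z; rewrite !mulmx1. Qed.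

Lemma stabM M N : stab M -> stab N -> stab (M *m N).
Proof. by move=> hM hN x y z; rewrite !mulmxA hN hM. Qed.

(** Polar form of a quaternion; the norm is a square root, available in a real closed field. *)
Lemma unit_quaternion (p q r s : R) : [/\ p = 0, q = 0, r = 0 & s = 0] \/
  exists n a b c d, [/\ a * a + b * b + c * c + d * d = 1,
    p = n * a, q = n * b, r = n * c & s = n * d].
Proof.
have ge0 := sqr_ge0.
have [/eqP|ne] := eqVneq (p ^+ 2 + q ^+ 2 + r ^+ 2 + s ^+ 2) 0.
  rewrite !paddr_eq0 ?addr_ge0 ?ge0 // !sqrf_eq0.
  by case/andP=> /andP[/andP[/eqP-> /eqP->] /eqP->] /eqP->; left.
right; set m := _ + _ in ne; exists (Num.sqrt m).
have m0 : 0 <= m by rewrite !addr_ge0 ?ge0.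
have n0 : Num.sqrt m != 0 by rewrite sqrtr_eq0 -ltNge lt_neqAle eq_sym ne.
have e : Num.sqrt m ^+ 2 = m by rewrite sqr_sqrtr.
exists (p / Num.sqrt m), (q / Num.sqrt m), (r / Num.sqrt m), (s / Num.sqrt m).
split; try by field.
by apply: (mulfI (expf_neq0 2 n0)); rewrite mulr1 {2}e /m; field.
Qed.

(* The subgroup of G2 fixing the vectors of a line of the Fano plane acts on the
   complementary 4-space as the unit quaternions by right multiplication, hence
   transitively on its unit sphere. *)
Lemma rotate_2345 x : exists M, [/\ stab M,
  forall y k, k \in [:: 0; 1; 6]%N -> (y *m M)`[k] = y`[k],
  forall y, (forall k, k \in [:: 2; 3; 4; 5]%N -> y`[k] = 0) -> y *m M = y &
  forall k, k \in [:: 2; 4; 5]%N -> (x *m M)`[k] = 0].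
Proof.
have [[e2 e3 e4 e5]|[n [a [b [c [d [e x2 x3 x4 x5]]]]]]] :=
  unit_quaternion (x`[2]) (x`[3]) (x`[4]) (x`[5]).
  exists 1%:M; split=> [| y k _ | y _ | k]; rewrite ?mulmx1 //; first exact: stab1.
  by rewrite !inE => /or3P[] /eqP->.
exists (mx7 [:: [:: 1]; [:: 0; 1];
  [:: 0; 0; b; - a; d; - c; 0]; [:: 0; 0; a; b; c; d; 0];
  [:: 0; 0; - d; - c; b; a; 0]; [:: 0; 0; c; - d; - a; b; 0];
  [:: 0; 0; 0; 0; 0; 0; 1]]); split=> [u v w | y k | y y0 | k].
- rewrite /phi0 /det3 !mul_mx7 //=.
  transitivity (det3 0 1 6 u v w + (a * a + b * b + c * c + d * d) *
   (phi0 u v w - det3 0 1 6 u v w)); last by rewrite e /phi0 /det3; ring.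
  by rewrite /phi0 /det3; ring.
- by rewrite !inE => /or3P[] /eqP->; rewrite mul_mx7 //=; ring.
- have [y2 y3 y4 y5] := And4 (y0 2%N isT) (y0 3%N isT) (y0 4%N isT) (y0 5%N isT).
  by apply: rV7P; rewrite mul_mx7 //= ?(y2, y3, y4, y5); ring.
- by rewrite !inE => /or3P[] /eqP->; rewrite mul_mx7 //= x2 x3 x4 x5; ring.
Qed.

Lemma rotate_0123 x : exists M, [/\ stab M,
  forall y k, k \in [:: 4; 5; 6]%N -> (y *m M)`[k] = y`[k],
  forall y, (forall k, k \in [:: 0; 1; 2; 3]%N -> y`[k] = 0) -> y *m M = y &
  forall k, k \in [:: 1; 2; 3]%N -> (x *m M)`[k] = 0].
Proof.
have [[e2 e3 e4 e5]|[n [a [b [c [d [e x2 x3 x4 x5]]]]]]] :=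
  unit_quaternion (x`[0]) (x`[1]) (x`[2]) (x`[3]).
  exists 1%:M; split=> [| y k _ | y _ | k]; rewrite ?mulmx1 //; first exact: stab1.
  by rewrite !inE => /or3P[] /eqP->.
exists (mx7 [:: [:: a; b; c; d; 0; 0; 0];
  [:: - b; a; - d; c; 0; 0; 0]; [:: - c; d; a; - b; 0; 0; 0];
  [:: - d; - c; b; a; 0; 0; 0]; [:: 0; 0; 0; 0; 1];
  [:: 0; 0; 0; 0; 0; 1];
  [:: 0; 0; 0; 0; 0; 0; 1]]); split=> [u v w | y k | y y0 | k].
- rewrite /phi0 /det3 !mul_mx7 //=.
  transitivity (det3 4 5 6 u v w + (a * a + b * b + c * c + d * d) *
   (phi0 u v w - det3 4 5 6 u v w)); last by rewrite e /phi0 /det3; ring.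
  by rewrite /phi0 /det3; ring.
- by rewrite !inE => /or3P[] /eqP->; rewrite mul_mx7 //=; ring.
- have [y2 y3 y4 y5] := And4 (y0 0%N isT) (y0 1%N isT) (y0 2%N isT) (y0 3%N isT).
  by apply: rV7P; rewrite mul_mx7 //= ?(y2, y3, y4, y5); ring.
- by rewrite !inE => /or3P[] /eqP->; rewrite mul_mx7 //= x2 x3 x4 x5; ring.
Qed.

Lemma rotate_0256 x : exists M, [/\ stab M,
  forall y k, k \in [:: 1; 3; 4]%N -> (y *m M)`[k] = y`[k] &
  forall k, k \in [:: 0; 2; 5]%N -> (x *m M)`[k] = 0].
Proof.
have [[e2 e3 e4 e5]|[n [a [b [c [d [e x2 x3 x4 x5]]]]]]] :=
  unit_quaternion (x`[0]) (x`[2]) (x`[5]) (x`[6]).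
  exists 1%:M; split=> [| y k _ | k]; rewrite ?mulmx1 //; first exact: stab1.
  by rewrite !inE => /or3P[] /eqP->.
exists (mx7 [:: [:: d; 0; c; 0; 0; - b; - a]; [:: 0; 1];
  [:: - c; 0; d; 0; 0; a; - b]; [:: 0; 0; 0; 1]; [:: 0; 0; 0; 0; 1];
  [:: b; 0; - a; 0; 0; d; - c]; [:: a; 0; b; 0; 0; c; d]]);
 split=> [u v w | y k | k].
- rewrite /phi0 /det3 !mul_mx7 //=.
  transitivity (- det3 1 3 4 u v w + (a * a + b * b + c * c + d * d) *
   (phi0 u v w + det3 1 3 4 u v w)); last by rewrite e /phi0 /det3; ring.
  by rewrite /phi0 /det3; ring.
- by rewrite !inE => /or3P[] /eqP->; rewrite mul_mx7 //=; ring.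
- by rewrite !inE => /or3P[] /eqP->; rewrite mul_mx7 //= x2 x3 x4 x5; ring.
Qed.

(** Three rotations shrink the support of [x] to 0, 1, 3, 6, then to 0, 6, then to 6. *)
Lemma stab_to6 x : exists M, stab M /\ forall k, (k < 6)%N -> (x *m M)`[k] = 0.
Proof.
have [A [sA fA _ zA]] := rotate_2345 x.
have [B [sB fB _ zB]] := rotate_0123 (x *m A).
have [C [sC fC zC]] := rotate_0256 (x *m A *m B).
exists (A *m B *m C); split; first exact: stabM (stabM sA sB) sC.
rewrite !mulmxA => k; do 6?[case: k => [|k]] => // _; do ?exact: zC.
- by rewrite fC // zB.
- by rewrite fC // zB.
- by rewrite fC // fB // zA.
Qed.

Lemma stab_to0 x : exists M, [/\ stab M,
  forall y, (forall k, (k < 6)%N -> y`[k] = 0) -> y *m M = y &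
  forall k, (0 < k < 6)%N -> (x *m M)`[k] = 0].
Proof.
have [A [sA fA iA zA]] := rotate_2345 x.
have [B [sB fB iB zB]] := rotate_0123 (x *m A).
exists (A *m B); split; first exact: stabM sA sB.
  move=> y y0; rewrite mulmxA iA ?iB // => k; rewrite !inE => /or4P[] /eqP->;
  exact: y0.
rewrite mulmxA => k; do 6?[case: k => [|k]] => // _; do ?exact: zB.
- by rewrite fB // zA.
- by rewrite fB // zA.
Qed.

(** Each rotation fixes what has already been placed: [w] goes to the line of 6, then [e] to the
    span of 0 and 6, and a last rotation fixing 0, 1, 6 adjusts [v]. *)
Lemma adapted_frame (w e v : 'rV[R]_7) : exists M, [/\ stab M,
  forall k, (k < 6)%N -> (w *m M)`[k] = 0,
  forall k, (0 < k < 6)%N -> (e *m M)`[k] = 0 &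
  forall k, k \in [:: 2; 4; 5]%N -> (v *m M)`[k] = 0].
Proof.
have [M1 [s1 z1]] := stab_to6 w.
have [M2 [s2 f2 z2]] := stab_to0 (e *m M1).
have [M3 [s3 f3 i3 z3]] := rotate_2345 (v *m M1 *m M2).
exists (M1 *m M2 *m M3); split; first exact: stabM (stabM s1 s2) s3.
- move=> k k6; rewrite !mulmxA f2 // i3 ?z1 // => j.
  by rewrite !inE => /or4P[] /eqP->; rewrite z1.
- move=> k k6; rewrite !mulmxA i3 ?z2 // => j.
  by rewrite !inE => /or4P[] /eqP->; rewrite z2.
- by move=> k k6; rewrite !mulmxA z3.
Qed.

End Rotations.

(** * Two-step algebras given by a 3 x 3 matrix *)

Local Notation o3 k := (inord k : 'I_3).

Local Notation entry M i j := (M (o3 i) (o3 j)).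

Definition minor2 (R : pzRingType) (x y : 'rV[R]_7) (i j : nat) : R :=
  x`[i] * y`[j] - x`[j] * y`[i].

Section TwoStep.
Variable (F : fieldType).
Implicit Types (u v : 'rV[F]_3) (M : 'M[F]_3).

Lemma big_o3 (V : nmodType) (f : 'I_3 -> V) :
  \sum_i f i = f (o3 0) + f (o3 1) + f (o3 2).
Proof.
rewrite !big_ord_recl big_ord0 addr0 !addrA.
by repeat congr (_ + _); congr f; apply/val_inj; rewrite /= inordK.
Qed.

Lemma o3_ind (P : 'I_3 -> Prop) : P (o3 0) -> P (o3 1) -> P (o3 2) -> forall i, P i.
Proof. by move=> ? ? ? i; rewrite -(inord_val i); case: i; do 3?[case=> //]. Qed.

Definition cross u v : 'rV[F]_3 := \row_k
  (let m i j := u 0 (o3 i) * v 0 (o3 j) - u 0 (o3 j) * v 0 (o3 i) in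
   nth 0 [:: m 1 2; m 2 0; m 0 1]%N k).

(** The cofactor identity; the witness is the determinant of [M]. *)
Lemma cross_mul M : exists d, forall u v,
  cross (u *m M) (v *m M) *m M^T = d *: cross u v.
Proof.
exists (entry M 0 0 * (entry M 1 1 * entry M 2 2 - entry M 1 2 * entry M 2 1)
  - entry M 0 1 * (entry M 1 0 * entry M 2 2 - entry M 1 2 * entry M 2 0)
  + entry M 0 2 * (entry M 1 0 * entry M 2 1 - entry M 1 1 * entry M 2 0)) => u v.
by apply/rowP; apply: o3_ind; rewrite !mxE !big_o3 !mxE !inordK //= !mxE !big_o3; ring.
Qed.

(** The scalar is tested on the preimages of the first two basis vectors, whose images have the
    third one as cross product. *)
Lemma cross_mul_unit M : M \in unitmx -> exists2 d, d != 0 &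
  forall u v, cross (u *m M) (v *m M) *m M^T = d *: cross u v.
Proof.
move=> uM; have [d hd] := cross_mul M; exists d => //; apply/eqP => d0.
have := hd (delta_mx 0 (o3 0) *m invmx M) (delta_mx 0 (o3 1) *m invmx M).
rewrite d0 scale0r !mulmxKV // => /(congr1 (mulmx^~ (invmx M^T))).
rewrite mulmxK ?unitmx_tr // mul0mx => /rowP/(_ (o3 2)).
rewrite !mxE !inordK //= !mxE -!val_eqE /= !inordK //= => /eqP.
by rewrite !mulr0 subr0 mulr1 oner_eq0.
Qed.

(** The blocks are three generators, three central values and one abelian direction. The cross
    product identifies the second exterior power of R^3 with R^3, so the rows of [M] are the
    brackets of the generator pairs 12, 20, 01. *)
Definition two_step M (x y : 'rV[F]_(3 + (3 + 1))) : 'rV[F]_(3 + (3 + 1)) :=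
  row_mx 0 (row_mx (cross (lsubmx x) (lsubmx y) *m M) 0).

Definition sc_two_step M : sconst F := sc_of (two_step M).

Lemma cross_linearl v : linear (cross^~ v).
Proof.
by move=> a u u'; apply/rowP; apply: o3_ind; rewrite !mxE !inordK //= !mxE; ring.
Qed.

Lemma cross_linearr u : linear (cross u).
Proof.
by move=> a v v'; apply/rowP; apply: o3_ind; rewrite !mxE !inordK //= !mxE; ring.
Qed.

Lemma two_step_linearl M y : linear (two_step M ^~ y).
Proof.
move=> a x x'; rewrite /two_step scale_row_mx add_row_mx scaler0 addr0.
rewrite scale_row_mx add_row_mx scaler0 addr0 linearP cross_linearl.
by rewrite mulmxDl -scalemxAl.
Qed.

Lemma two_step_linearr M x : linear (two_step M x).
Proof.
move=> a y y'; rewrite /two_step scale_row_mx add_row_mx scaler0 addr0.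
rewrite scale_row_mx add_row_mx scaler0 addr0 linearP cross_linearr.
by rewrite mulmxDl -scalemxAl.
Qed.

Lemma lbr_two_step M x y : lbr (sc_two_step M) x y = two_step M x y.
Proof.
by apply: lbr_sc_of => z; [exact: two_step_linearl | exact: two_step_linearr].
Qed.

Lemma lie_iso_two_step M M' X Y : X \in unitmx -> Y \in unitmx ->
  (forall u v, cross (u *m X) (v *m X) *m M' = cross u v *m M *m Y) ->
  lie_iso (sc_two_step M) (sc_two_step M').
Proof.
move=> uX uY h; pose Z : 'M_(3 + 1) := block_mx Y 0 0 1%:M.
pose L : 'M_(3 + (3 + 1)) := block_mx X 0 0 Z.
have uL : L \in unitmx.
  by rewrite unitmxE /L /Z !det_ublock det1 mulr1 unitrM -!unitmxE uX.
have hL x y : two_step M' (x *m L) (y *m L) = two_step M x y *m L.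
  have lsubM z : lsubmx (z *m L) = lsubmx z *m X.
    by rewrite -{1}[z]hsubmxK mul_row_block row_mxKl mulmx0 addr0.
  rewrite /two_step !lsubM h mul_row_block !mul0mx !mulmx0 !add0r; congr row_mx.
  by rewrite mul_row_block !mul0mx !mulmx0 !addr0.
by exists L; split=> // x y; rewrite !lbr_two_step hL.
Qed.

(** By the cofactor identity, changing the generators by the inverse transpose of [A] multiplies the
    cross product by [A] on the right, up to a scalar [d] that the change of values absorbs. *)
Lemma lie_iso_two_step_pid M A B r : A \in unitmx -> B \in unitmx ->
  M = A *m pid_mx r *m B ->
  lie_iso (sc_two_step M) (sc_two_step (pid_mx r)).
Proof.
move=> uA uB ->; pose X := (invmx A)^T.
have uX : X \in unitmx by rewrite unitmx_tr unitmx_inv.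
have [d d0 hd] := cross_mul_unit uX.
apply: (@lie_iso_two_step _ _ X (d *: invmx B)) => // [|u v].
  by rewrite unitmxZ ?unitfE // unitmx_inv.
have -> : cross (u *m X) (v *m X) = d *: cross u v *m A.
  by rewrite -hd -mulmxA trmxK mulVmx // mulmx1.
by rewrite -!scalemxAl -scalemxAr !mulmxA mulmxK.
Qed.

(** Generators and values can be changed independently, so only the equivalence class of the matrix
    matters. *)
Lemma lie_iso_two_step_rank M M' : \rank M = \rank M' ->
  lie_iso (sc_two_step M) (sc_two_step M').
Proof.
move=> e; have h N : lie_iso (sc_two_step N) (sc_two_step (pid_mx (\rank N))).
  apply: (@lie_iso_two_step_pid _ (col_ebase N) (row_ebase N)).
  - exact: col_ebase_unit.
  - exact: row_ebase_unit.
  - by rewrite mulmx_ebase.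
by apply: lie_iso_trans (h M) _; rewrite e; apply: lie_iso_sym.
Qed.

Lemma two_step_coord M (x y : 'rV[F]_7) (k : nat) : (k < 7)%N ->
  (two_step M x y)`[k] = if (2 < k < 6)%N then
    minor2 x y 1 2 * M (o3 0) (o3 (k - 3)) + minor2 x y 2 0 * M (o3 1) (o3 (k - 3))
    + minor2 x y 0 1 * M (o3 2) (o3 (k - 3)) else 0.
Proof.
move=> k7.
have lsubE (z : 'rV_(3 + (3 + 1))) i : (i < 3)%N -> (lsubmx z) 0 (o3 i) = z`[i].
  move=> i3; rewrite mxE; congr (z _ _); apply: val_inj.
  by rewrite /= !inordK // (ltn_trans i3).
have [k3|k3] := ltnP k 3.
  have -> : o7 k = lshift (3 + 1) (o3 k) by apply: val_inj; rewrite /= !inordK.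
  by rewrite row_mxEl mxE.
have [k6|k6] := ltnP k 6; last first.
  have -> : o7 k = rshift 3 (rshift 3 (0 : 'I_1)).
    by apply: val_inj; rewrite /= inordK //; apply/eqP; rewrite eqn_leq k6 andbT.
  by rewrite !row_mxEr mxE.
have -> : o7 k = rshift 3 (lshift 1 (o3 (k - 3))).
  by apply: val_inj; rewrite /= !inordK ?subnKC // ltn_subLR.
rewrite row_mxEr row_mxEl mxE big_o3 !mxE !inordK //= !lsubE //.
Qed.

Lemma lbr_mk_sc (l : seq (nat * nat * nat)) x y k :
  all (fun t => [&& t.1.1 < 7, t.1.2 < 7 & t.2 < 7])%N l -> (k < 7)%N ->
  (lbr (mk_sc F l) x y)`[k] = \sum_(t <- l)
    (x`[t.1.2] * y`[t.1.1] - x`[t.1.1] * y`[t.1.2]) * (k == t.2)%:R.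
Proof.
move=> hl k7; rewrite lbrE /mk_sc.
under eq_bigr do under eq_bigr do rewrite mulr_sumr.
under eq_bigr do rewrite exchange_big /=.
rewrite exchange_big /= big_seq [RHS]big_seq; apply: eq_bigr => -[[a b] m] /(allP hl) /=.
case/and3P=> a7 b7 m7.
have pick (i0 j0 : nat) : (i0 < 7)%N -> (j0 < 7)%N ->
  \sum_i \sum_j x 0 i * y 0 j *
    (nat_of_bool [&& (i : nat) == i0, (j : nat) == j0 & (o7 k : nat) == m])%:R
    = x`[i0] * y`[j0] * (k == m)%:R.
  move=> i7 j7; rewrite (bigD1 (o7 i0)) //= (bigD1 (o7 j0)) //= !inordK // !eqxx /=.
  rewrite big1 => [|j nej]; last first.
    by rewrite -val_eqE /= inordK // in nej; rewrite (negPf nej) mulr0.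
  rewrite big1 ?addr0 // => i nei; rewrite big1 // => j _.
  by rewrite -val_eqE /= inordK // in nei; rewrite (negPf nei) mulr0.
rewrite mulrBl -!pick // -sumrB; apply: eq_bigr => i _.
by rewrite -sumrB; apply: eq_bigr => j _; rewrite mulrBr.
Qed.

End TwoStep.

(** Here [s] lists the rows, in contrast to [mx7]; missing entries are again 0. *)
Definition mx3 (R : nzRingType) (s : seq (seq R)) : 'M[R]_3 :=
  \matrix_(i, j) nth 0 (nth [::] s i) j.

(* [M - M^T] is the matrix of the cross product with [- M mu]. *)
Definition trace_skew (R : pzRingType) (M : 'M[R]_3) (mu : 'cV[R]_3) : Prop :=
  [/\ entry M 0 0 + entry M 1 1 + entry M 2 2 = 0,
    entry M 0 1 - entry M 1 0 = - (M *m mu) (o3 2) 0,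
    entry M 0 2 - entry M 2 0 = (M *m mu) (o3 1) 0 &
    entry M 1 2 - entry M 2 1 = - (M *m mu) (o3 0) 0].

(** * The model algebras and their calibrated forms *)

Section Models.
Variable F : fieldType.

(** The generators occupy the places 1, 2, 5 of the adapted basis, which form a line, their brackets
    the places 6, 4, 3, and the abelian direction the place 0. The differential of the form is then
    a multiple of the trace, hence the last entry [- a - b]. *)
Lemma two_step_diag_calibrated (a b : F) :
  has_calibrated_G2 (sc_two_step (mx3 [:: [:: a; 0; 0]; [:: 0; b; 0]; [:: 0; 0; - a - b]])).
Proof.
set c := sc_two_step _.
exists (mx7 [:: [:: 0; 0; 0; 0; 0; 0; 1]; [:: 1]; [:: 0; 1]; [:: 0; 0; 0; 0; 0; 1];
  [:: 0; 0; 0; 0; 1]; [:: 0; 0; 1]; [:: 0; 0; 0; 1]]).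
set P := mx7 _.
have PE (x : 'rV[F]_7) : [/\ (x *m P)`[0] = x`[6], (x *m P)`[1] = x`[0],
   (x *m P)`[2] = x`[1] & (x *m P)`[3] = x`[5]] /\
   [/\ (x *m P)`[4] = x`[4], (x *m P)`[5] = x`[2] & (x *m P)`[6] = x`[3]].
  by split; split; rewrite mul_mx7 //=; ring.
split.
  apply: unitmx_ker => x x0; have [[]] := PE x; rewrite x0 => e6 e0 e1 e5 [e4 e2 e3].
  by apply: rV7P; rewrite -?(e0, e1, e2, e3, e4, e5, e6) !mxE.
have cE (x y : 'rV[F]_7) : [/\ (lbr c x y)`[0] = 0, (lbr c x y)`[1] = 0,
   (lbr c x y)`[2] = 0 & (lbr c x y)`[3] = a * minor2 x y 1 2] /\
   [/\ (lbr c x y)`[4] = b * minor2 x y 2 0,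
     (lbr c x y)`[5] = (- a - b) * minor2 x y 0 1 & (lbr c x y)`[6] = 0].
  by split; split; rewrite lbr_two_step two_step_coord //= !mxE !inordK //= /minor2; ring.
have phiE y z u v : phiG2 P (lbr c y z) u v =
  a * minor2 y z 1 2 * (minor2 u v 6 0 + minor2 u v 1 5 + minor2 u v 4 2)
  + b * minor2 y z 2 0 * (minor2 u v 2 3 + minor2 u v 6 1 - minor2 u v 0 5)
  + (- a - b) * minor2 y z 0 1 * (minor2 u v 3 1 - minor2 u v 2 6 - minor2 u v 4 0).
  have [[h0 h1 h2 h3] [h4 h5 h6]] := cE y z.
  rewrite phiG2E /phi0 /det3.
  have [[-> -> -> ->] [-> -> ->]] := PE (lbr c y z).
  have [[-> -> -> ->] [-> -> ->]] := PE u.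
  have [[-> -> -> ->] [-> -> ->]] := PE v.
  by rewrite h0 h1 h2 h3 h4 h5 h6 /minor2; ring.
by move=> x0 x1 x2 x3; rewrite /d3 !phiE /minor2; ring.
Qed.

Lemma mx3P (A B : 'M[F]_3) :
  (forall i j : nat, (i < 3)%N -> (j < 3)%N -> A (o3 i) (o3 j) = B (o3 i) (o3 j)) -> A = B.
Proof. by move=> h; apply/matrixP; apply: o3_ind => j; move: j; apply: o3_ind; apply: h. Qed.

Lemma unit_mx3 (s t : seq (seq F)) :
  (forall i j : nat, (i < 3)%N -> (j < 3)%N ->
    let e (k : nat) := nth 0 (nth [::] s i) k * nth 0 (nth [::] t k) j in
    e 0%N + e 1%N + e 2%N = (i == j)%:R) ->
  mx3 s \in unitmx.
Proof.
move=> h; suff /mulmx1_unit[] : mx3 s *m mx3 t = 1%:M by [].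
apply: mx3P => i j i3 j3; rewrite mxE big_o3 !mxE !inordK // h //.
by rewrite -val_eqE /= !inordK.
Qed.

Lemma rank_pidM (A B : 'M[F]_3) r : (r <= 3)%N -> A \in unitmx -> B \in unitmx ->
  \rank (A *m pid_mx r *m B) = r.
Proof.
move=> r3 uA uB; rewrite mxrankMfree ?row_free_unit //.
by rewrite (eqmxMfull _ _) ?row_full_unit // rank_pid_mx.
Qed.

(** The signs come from the convention that the bracket of e_a and e_b is - e_k; the middle row has
    the opposite sign because it records the pair 20 and not 02. *)
Definition mx_n1 : 'M[F]_3 := mx3 [:: [::]; [:: 0; 0; 1]; [:: 0; - 1]].
Definition mx_n2 : 'M[F]_3 := mx3 [:: [:: 0; 0; - 1]; [:: 0; 1]; [:: - 1]].

Lemma lie_iso_eq (c c' : sconst F) : (forall x y, lbr c x y = lbr c' x y) -> lie_iso c c'.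
Proof. by move=> h; exists 1%:M; rewrite unitmx1; split=> // x y; rewrite !mulmx1 h. Qed.

Lemma lie_ab_two_step : lie_iso (sc_two_step 0) (lie_ab F).
Proof.
apply: lie_iso_eq => x y; rewrite lbr_two_step.
by apply: rV7P; rewrite two_step_coord // lbr_mk_sc // big_nil ?mxE; ring.
Qed.

Lemma lie_n1_two_step : lie_iso (sc_two_step mx_n1) (lie_n1 F).
Proof.
apply: lie_iso_eq => x y; rewrite lbr_two_step.
by apply: rV7P; rewrite two_step_coord // lbr_mk_sc // !big_cons big_nil /=
  ?mxE ?inordK //= /minor2; ring.
Qed.

Lemma lie_n2_two_step : lie_iso (sc_two_step mx_n2) (lie_n2 F).
Proof.
apply: lie_iso_eq => x y; rewrite lbr_two_step.
by apply: rV7P; rewrite two_step_coord // lbr_mk_sc // !big_cons big_nil /=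
  ?mxE ?inordK //= /minor2; ring.
Qed.

Lemma rank_mx_n2 : \rank mx_n2 = 3.
Proof.
apply/mxrank_unit/(unit_mx3 (t := [:: [:: 0; 0; - 1]; [:: 0; 1]; [:: - 1]])).
by move=> i j; do 3?[case: i => [|i]] => //; do 3?[case: j => [|j]] => // _ _ /=; ring.
Qed.

Lemma rank_mx_n1 : \rank mx_n1 = 2.
Proof.
pose A : 'M[F]_3 := mx3 [:: [:: 0; 0; 1]; [:: 0; 1]; [:: 1]].
pose B : 'M[F]_3 := mx3 [:: [:: 0; - 1]; [:: 0; 0; 1]; [:: 1]].
have -> : mx_n1 = A *m pid_mx 2 *m B.
  by apply: mx3P => i j; do 3?[case: i => [|i]] => //; do 3?[case: j => [|j]] => // _ _;
    rewrite !mxE !big_o3 !mxE !big_o3 !mxE -?val_eqE /= !inordK //=; ring.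
apply: rank_pidM => //.
  apply/(unit_mx3 (t := [:: [:: 0; 0; 1]; [:: 0; 1]; [:: 1]])).
  by move=> i j; do 3?[case: i => [|i]] => //; do 3?[case: j => [|j]] => // _ _ /=; ring.
apply/(unit_mx3 (t := [:: [:: 0; 0; 1]; [:: - 1]; [:: 0; 1]])).
by move=> i j; do 3?[case: i => [|i]] => //; do 3?[case: j => [|j]] => // _ _ /=; ring.
Qed.

Lemma calibrated_ab : has_calibrated_G2 (lie_ab F).
Proof.
apply: lie_iso_calibrated (lie_iso_sym lie_ab_two_step) _.
have -> : 0 = mx3 [:: [:: 0; 0; 0]; [:: 0; 0; 0]; [:: 0; 0; - 0 - 0 : F]].
  by apply: mx3P => i j; do 3?[case: i => [|i]] => //; do 3?[case: j => [|j]] => // _ _;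
    rewrite !mxE !inordK //=; ring.
exact: two_step_diag_calibrated.
Qed.

Lemma calibrated_n1 : has_calibrated_G2 (lie_n1 F).
Proof.
apply: lie_iso_calibrated (lie_iso_sym lie_n1_two_step) _.
(* The matrix diag(1, -1, 0) has rank 2. *)
have h := @two_step_diag_calibrated 1 (- 1).
apply: lie_iso_calibrated h; apply: lie_iso_two_step_rank; rewrite rank_mx_n1.
pose B : 'M[F]_3 := mx3 [:: [:: 1]; [:: 0; - 1]; [:: 0; 0; 1]].
set M := mx3 _; have -> : M = 1%:M *m pid_mx 2 *m B.
  by rewrite mul1mx; apply: mx3P => i j;
    do 3?[case: i => [|i]] => //; do 3?[case: j => [|j]] => // _ _;
    rewrite !mxE !big_o3 !mxE -?val_eqE /= !inordK //=; ring.
rewrite rank_pidM ?unitmx1 //; apply/(unit_mx3 (t := [:: [:: 1]; [:: 0; - 1]; [:: 0; 0; 1]])).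
by move=> i j; do 3?[case: i => [|i]] => //; do 3?[case: j => [|j]] => // _ _ /=; ring.
Qed.

Lemma calibrated_n2 : (2 : F) != 0 -> has_calibrated_G2 (lie_n2 F).
Proof.
move=> two; apply: lie_iso_calibrated (lie_iso_sym lie_n2_two_step) _.
(* The matrix diag(1, 1, -2) is invertible as soon as 2 is. *)
have h := @two_step_diag_calibrated 1 1.
apply: lie_iso_calibrated h; apply: lie_iso_two_step_rank; rewrite rank_mx_n2.
apply/esym/mxrank_unit/(unit_mx3 (t := [:: [:: 1]; [:: 0; 1]; [:: 0; 0; - 2^-1]])).
by move=> i j; do 3?[case: i => [|i]] => //; do 3?[case: j => [|j]] => // _ _ /=; field.
Qed.

End Models.

(** * Structure constants in an adapted basis *)

(* [phi0 u (dl k) (dl l)] is, up to sign, the coordinate of [u] completing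
   [{k, l}] to a line of the Fano plane; [true] stands for a minus sign. *)
Definition fano (k l : nat) : bool * nat :=
  nth (false, 0)%N (nth [::] [::
    [:: (false, 0); (false, 6); (false, 4); (true, 5); (true, 2); (false, 3); (true, 1)];
    [:: (false, 0); (false, 0); (true, 5); (true, 4); (false, 3); (false, 2); (false, 0)];
    [:: (false, 0); (false, 0); (false, 0); (false, 6); (false, 0); (true, 1); (true, 3)];
    [:: (false, 0); (false, 0); (false, 0); (false, 0); (true, 1); (true, 0); (false, 2)];
    [:: (false, 0); (false, 0); (false, 0); (false, 0); (false, 0); (false, 6); (true, 5)];
    [:: (false, 0); (false, 0); (false, 0); (false, 0); (false, 0); (false, 0); (false, 4)]
    ] k)%N l.

Lemma phi0_dl (R : comNzRingType) (u : 'rV[R]_7) (k l : nat) :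
  (k < l < 7)%N -> phi0 u (dl k) (dl l) = (-1) ^+ (fano k l).1 * u`[(fano k l).2].
Proof.
case/andP=> kl l7; have k7 := ltn_trans kl l7.
rewrite /phi0 /det3 !dlE //; move: kl l7 {k7}.
by do 7?[case: l => [|l]] => //; do 6?[case: k => [|k]] => // _ _;
  rewrite /fano /= ?expr0 ?expr1; ring.
Qed.

Section StructureConstants.
Variables (R : rcfType) (c : sconst R) (lam : 'cV[R]_7).
Local Notation g i j k := (c (o7 i) (o7 j) (o7 k)).
Local Notation l i := (lam (o7 i) 0).

Implicit Types (x y z : 'rV[R]_7).

Hypothesis lieP : is_lie c.
Hypothesis nilP : lie_nilpotent c.
Hypothesis closedP : forall x0 x1 x2 x3, d3 c (@phi0 R) x0 x1 x2 x3 = 0.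
Hypothesis center0 : forall x, lbr c (dl 0) x = 0.
Hypothesis center6 : forall x, lbr c (dl 6) x = 0.
Hypothesis lam0 : l 0 = 1.
Hypothesis lam6 : l 6 = 0.
Hypothesis lamP : forall x y, lbr c x y *m lam = 0.
(* Coordinate 3 is the direction of a vector central modulo the vector 6. *)
Hypothesis center3 : forall x k, (k < 6)%N -> (lbr c x (dl 3))`[k] = 0.

Lemma gE i j k : g i j k = (lbr c (dl i) (dl j))`[k].
Proof. by rewrite lbr_delta mxE. Qed.

Lemma g_sym i j k : g i j k = - g j i k.
Proof. by rewrite !gE (lbrC lieP) mxE. Qed.

Lemma g_diag i k : g i i k = 0.
Proof. by have [alt _] := lieP; rewrite gE alt mxE. Qed.

Lemma g0j j k : g 0 j k = 0. Proof. by rewrite gE center0 mxE. Qed.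
Lemma g6j j k : g 6 j k = 0. Proof. by rewrite gE center6 mxE. Qed.
Lemma gi0 i k : g i 0 k = 0. Proof. by rewrite g_sym g0j oppr0. Qed.
Lemma gi6 i k : g i 6 k = 0. Proof. by rewrite g_sym g6j oppr0. Qed.
Lemma gi3 i k : (k < 6)%N -> g i 3 k = 0.
Proof. by move=> hk; rewrite gE center3. Qed.
Lemma g3j j k : (k < 6)%N -> g 3 j k = 0.
Proof. by move=> hk; rewrite g_sym gi3 // oppr0. Qed.

Lemma lbr_dl i x k : (lbr c (dl i) x)`[k] =
  x`[1] * g i 1 k + x`[2] * g i 2 k + x`[3] * g i 3 k + x`[4] * g i 4 k
  + x`[5] * g i 5 k.
Proof.
rewrite lbrE (bigD1 (o7 i)) //= [X in _ + X]big1 ?addr0.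
  by rewrite big_o7 !mxE !eqxx gi0 gi6 !mul1r; ring.
by move=> j /negPf ne; rewrite big1 // => m _; rewrite !mxE ne andbF !mul0r.
Qed.

(** Closedness on four basis vectors, with every value of the form read off the Fano table. *)
Lemma d3_dl i j k m : (i < j < k)%N -> (k < m < 7)%N ->
  let f a b p q := (-1) ^+ (fano p q).1 * g a b (fano p q).2 in
  f i j k m - f i k j m + f i m j k + f j k i m - f j m i k + f k m i j = 0.
Proof.
case/andP=> ij jk /andP[km m7] f.
have [jm ik] := (ltn_trans jk km, ltn_trans ij jk).
have im := ltn_trans ij jm; have k7 := ltn_trans km m7.
have j7 := ltn_trans jk k7.
rewrite -(closedP (dl i) (dl j) (dl k) (dl m)) /d3.
by rewrite !phi0_dl ?ij ?im ?ik ?jm ?jk ?km ?j7 ?k7 ?m7 // /f; cbv beta; rewrite !gE.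
Qed.

(** As [lam] kills brackets, the coordinate 0 of a bracket is determined by the coordinates 1 to
    5. *)
Lemma lam_g i j : g i j 0 = - (l 1 * g i j 1 + l 2 * g i j 2 + l 3 * g i j 3
  + l 4 * g i j 4 + l 5 * g i j 5).
Proof.
have := congr1 (fun M : 'M_1 => M 0 0) (lamP (dl i) (dl j)).
rewrite lbr_delta !mxE big_o7 !mxE lam0 lam6 => e; apply/eqP.
by rewrite -subr_eq0 -e; apply/eqP; ring.
Qed.

Lemma jacobi i j k n :
  let br i j k := g j k 1 * g i 1 n + g j k 2 * g i 2 n + g j k 3 * g i 3 n
    + g j k 4 * g i 4 n + g j k 5 * g i 5 n in
  br i j k + br j k i + br k i j = 0.
Proof.
case: lieP => _ /(_ (dl i) (dl j) (dl k)) /rowP/(_ (o7 n)).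
rewrite mxE [X in X + _]mxE !(lbr_dl _ (lbr _ _ _)) -!gE mxE => <-.
by [].
Qed.

(** On the span of the vectors 0, 3, 4, 6, bracketing with [x] multiplies the coordinate 4 by [mu];
    iterating from the vector 4 yields a power of [mu] that nilpotency makes 0. *)
Lemma nil_eigen (x : 'rV[R]_7) (mu : R) :
  (forall y : 'rV[R]_7, [/\ y`[1] = 0, y`[2] = 0 & y`[5] = 0] ->
     let z := lbr c x y in
     [/\ z`[1] = 0, z`[2] = 0 & z`[5] = 0] /\ z`[4] = mu * y`[4]) ->
  mu = 0.
Proof.
move=> h; have [n nil] := nilP.
suff [_]: let z := foldr (lbr c) (dl 4) (nseq n x) in
    [/\ z`[1] = 0, z`[2] = 0 & z`[5] = 0] /\ z`[4] = mu ^+ n.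
  rewrite nil ?size_nseq // mxE => /esym/eqP.
  by rewrite expf_eq0 => /andP[_ /eqP].
elim: n {nil} => [|n [IH e]] /=; first by rewrite !dlE.
by have [IH1 ->] := h _ IH; rewrite e exprS.
Qed.

Let g_sorted := (g_diag, gi0, g0j, (g_sym 2 1), (g_sym 3 1), (g_sym 3 2),
  (g_sym 4 1), (g_sym 4 2), (g_sym 4 3), (g_sym 5 1), (g_sym 5 2), (g_sym 5 3),
  (g_sym 5 4)).

Let g3_zero := (
  (@gi3 1 0 isT, @gi3 1 1 isT, @gi3 1 2 isT, @gi3 1 3 isT, @gi3 1 4 isT, @gi3 1 5 isT),
  (@gi3 2 0 isT, @gi3 2 1 isT, @gi3 2 2 isT, @gi3 2 3 isT, @gi3 2 4 isT, @gi3 2 5 isT),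
  (@g3j 4 0 isT, @g3j 4 1 isT, @g3j 4 2 isT, @g3j 4 3 isT, @g3j 4 4 isT, @g3j 4 5 isT),
  (@g3j 5 0 isT, @g3j 5 1 isT, @g3j 5 2 isT, @g3j 5 3 isT, @g3j 5 4 isT, @g3j 5 5 isT))%N.

Ltac d3_at i j k m :=
  have := @d3_dl i j k m isT isT;
  rewrite /fano /= ?expr0 ?expr1 ?mul1r ?mulN1r ?g0j ?gi6
    ?g3_zero ?oppr0 ?add0r ?addr0.

(** Closedness on two of the vectors 0, 3, 6 together with x, y isolates the coordinate of the
    bracket of x and y that completes the two to a line: the pairs 06, 36, 03 yield the coordinates
    1, 2, 5. For the pair 03 neither x nor y may be the vector 1. *)
Lemma g_zero : [/\
  [/\ g 1 2 1 = 0, g 1 4 1 = 0, g 1 5 1 = 0, g 2 4 1 = 0 & g 2 5 1 = 0] /\ g 4 5 1 = 0,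
  [/\ g 1 2 2 = 0, g 1 4 2 = 0, g 1 5 2 = 0, g 2 4 2 = 0 & g 2 5 2 = 0] /\ g 4 5 2 = 0,
  [/\ g 2 4 5 = 0, g 2 5 5 = 0 & g 4 5 5 = 0] &
  [/\ g 2 4 4 = 0, g 2 4 3 = 0, g 4 5 4 = 0 & g 4 5 3 = 0]].
Proof.
have h1 : [/\ g 1 2 1 = 0, g 1 4 1 = 0, g 1 5 1 = 0, g 2 4 1 = 0 & g 2 5 1 = 0]
    /\ g 4 5 1 = 0.
  split; [split|].
  - by d3_at 0%N 1%N 2%N 6%N; lra.
  - by d3_at 0%N 1%N 4%N 6%N; lra.
  - by d3_at 0%N 1%N 5%N 6%N; lra.
  - by d3_at 0%N 2%N 4%N 6%N; lra.
  - by d3_at 0%N 2%N 5%N 6%N; lra.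
  - by d3_at 0%N 4%N 5%N 6%N; lra.
have h2 : [/\ g 1 2 2 = 0, g 1 4 2 = 0, g 1 5 2 = 0, g 2 4 2 = 0 & g 2 5 2 = 0]
    /\ g 4 5 2 = 0.
  split; [split|].
  - by d3_at 1%N 2%N 3%N 6%N; lra.
  - by d3_at 1%N 3%N 4%N 6%N; lra.
  - by d3_at 1%N 3%N 5%N 6%N; lra.
  - by d3_at 2%N 3%N 4%N 6%N; lra.
  - by d3_at 2%N 3%N 5%N 6%N; lra.
  - by d3_at 3%N 4%N 5%N 6%N; lra.
have h5 : [/\ g 2 4 5 = 0, g 2 5 5 = 0 & g 4 5 5 = 0].
  split.
  - by d3_at 0%N 2%N 3%N 4%N; lra.
  - by d3_at 0%N 2%N 3%N 5%N; lra.
  - by d3_at 0%N 3%N 4%N 5%N; lra.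
have [[_ _ _ e241 e251] e451] := h1.
have [[_ _ _ e242 e252] e452] := h2.
have [e245 e255 e455] := h5.
(* Modulo the vectors 0, 3, 6, the vector 4 is an eigenvector of the bracket with the vector 2;
   likewise for the vector 5 below. *)
have e244 : g 2 4 4 = 0.
  apply: (nil_eigen (x := dl 2)) => y [y1 y2 y5] /=.
  rewrite !lbr_dl y1 y2 y5 e241 e242 e245 !(gi3 2) //.
  by split; [split|]; ring.
have e454 : g 4 5 4 = 0.
  rewrite g_sym -[RHS]oppr0; congr (- _).
  apply: (nil_eigen (x := dl 5)) => y [y1 y2 y5] /=.
  rewrite !lbr_dl y1 y2 y5 !(g_sym 5 4) e451 e452 e455 !(gi3 5) //.
  by split; [split|]; ring.
split=> //; split=> //.
- by d3_at 0%N 2%N 4%N 5%N; lra.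
- by d3_at 2%N 4%N 5%N 6%N; lra.
Qed.

Lemma lbr_coord x y k : let w := minor2 x y in
  (lbr c x y)`[k] = w 1 2 * g 1 2 k + w 1 3 * g 1 3 k + w 1 4 * g 1 4 k
    + w 1 5 * g 1 5 k + w 2 3 * g 2 3 k + w 2 4 * g 2 4 k + w 2 5 * g 2 5 k
    + w 3 4 * g 3 4 k + w 3 5 * g 3 5 k + w 4 5 * g 4 5 k.
Proof.
by move=> w; rewrite lbrE !big_o7 ?g_sorted !g6j !gi6 /w /minor2; ring.
Qed.

(* Unless all brackets are multiples of the vector 6, the vector 3 is itself a
   bracket up to the central directions. *)
Hypothesis bracket3 : (forall x y k, (k < 6)%N -> (lbr c x y)`[k] = 0) \/
  exists x y, (lbr c x y)`[3] != 0 /\ (lbr c x y)`[5] = 0.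

(** Closedness expresses all ten constants by t = [g 1 4 5], s = [g 1 4 4] and m = [g 1 4 3]. The
    Jacobi identity makes s and m vanish with t, and t is 0 because of [bracket3]. *)
Lemma g_center : [/\ g 1 2 5 = 0, g 1 4 3 = 0, g 1 4 4 = 0, g 1 4 5 = 0 & g 1 5 5 = 0]
  /\ [/\ g 2 3 6 = 0, g 2 4 6 = 0, g 3 4 6 = 0, g 3 5 6 = 0 & g 4 5 6 = 0].
Proof.
have [[[e121 e141 e151 e241 e251] e451] [[e122 e142 e152 e242 e252] e452]
  [e245 e255 e455] [e244 e243 e454 e453]] := g_zero.
have e240 : g 2 4 0 = 0 by rewrite lam_g e241 e242 e243 e244 e245; ring.
have e450 : g 4 5 0 = 0 by rewrite lam_g e451 e452 e453 e454 e455; ring.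
have e125 : g 1 2 5 = g 1 4 3 by d3_at 1%N 2%N 4%N 6%N; lra.
have e236 : g 2 3 6 = g 1 2 5 by d3_at 0%N 1%N 2%N 3%N; lra.
have e456 : g 4 5 6 = - g 1 4 3 by d3_at 0%N 1%N 4%N 5%N; lra.
have e155 : g 1 5 5 = - g 1 4 4 by d3_at 1%N 4%N 5%N 6%N; lra.
have e356 : g 3 5 6 = - g 1 5 5 by d3_at 0%N 1%N 3%N 5%N; lra.
have e246 : g 2 4 6 = g 1 4 4 by d3_at 0%N 1%N 2%N 4%N; lra.
have e346 : g 3 4 6 = - g 1 4 5 by d3_at 0%N 1%N 3%N 4%N; lra.
have e256 : g 2 5 6 = g 1 5 4 - g 1 2 3 by d3_at 0%N 1%N 2%N 5%N; lra.
have J135 : g 1 4 4 ^+ 2 = - (g 1 4 5 * g 1 5 4).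
  have := jacobi 1 3 5 6; rewrite /= ?g_sorted ?g3_zero.
  by rewrite e151 e152 e155 e356 e346 e155; lra.
have J145 : g 1 4 5 * g 1 5 3 = - (g 1 4 4 * g 1 4 3).
  have := jacobi 1 4 5 6; rewrite /= ?g_sorted.
  rewrite e151 e152 e155 e141 e142 e246 e346 e356 e456.
  by rewrite e451 e452 e453 e454 e455 e155; lra.
have J124 k : (k < 6)%N -> g 1 4 5 * g 2 5 k = 0.
  move=> k6; have := jacobi 1 2 4 k; rewrite /= ?g_sorted.
  rewrite e241 e242 e243 e244 e245 e121 e122 e141 e142 (gi3 2) // (g3j 4) //.
  have -> : g 2 4 k = 0.
    by move: k6; do 6?[case: k => [|k]] => // _.
  have : g 4 5 k = 0.
    by move: k6; do 6?[case: k => [|k]] => // _.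
  by move=> ->; lra.
have J1246 : g 1 4 5 * (g 1 2 3 + g 1 2 3 - g 1 5 4) = 2 * g 1 4 3 ^+ 2 + g 1 4 4 ^+ 2.
  have := jacobi 1 2 4 6; rewrite /= ?g_sorted.
  rewrite e241 e242 e243 e244 e245 e121 e122 e141 e142 e236 e246 e346 e456 e256 e125.
  by lra.
(* With t = 0, [J135] says that s^2 = 0, and then [J1246] that 2 m^2 = 0. *)
suff t0 : g 1 4 5 = 0.
  have s0 : g 1 4 4 = 0 by apply/eqP; rewrite -sqrf_eq0 J135 t0 mul0r oppr0.
  have m0 : g 1 4 3 = 0.
    apply/eqP; rewrite -sqrf_eq0; move: J1246; rewrite t0 s0 => J.
    by apply/eqP; lra.
  by split; split; rewrite ?e356 ?e236 ?e456 ?e155 ?e246 ?e346 ?e125 ?t0 ?s0 ?m0 ?oppr0.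
apply/eqP/negPn/negP => tN0.
(* Otherwise the functional g145 f^3 - g143 f^5 kills every bracket, but not the
   one provided by [bracket3]. *)
case: bracket3 => [z | [x [y [nz e]]]].
  by move: tN0; rewrite gE z // eqxx.
move: nz; rewrite -(mulrI_eq0 _ (mulfI tN0)).
have -> : g 1 4 5 * (lbr c x y)`[3] = g 1 4 3 * (lbr c x y)`[5].
  rewrite !lbr_coord ?g3_zero e243 e453 e245 e255 e455 e155 e125.
  (* Substituting [J135] into [J1246] cancels s^2 against the term in [g 1 5 4]. *)
  have e123 : g 1 4 5 * g 1 2 3 = g 1 4 3 ^+ 2 by lra.
  pose w := minor2 x y.
  transitivity (w 1 2 * (g 1 4 5 * g 1 2 3) + w 1 4 * (g 1 4 5 * g 1 4 3)
    + w 1 5 * (g 1 4 5 * g 1 5 3) + w 2 5 * (g 1 4 5 * g 2 5 3)); rewrite /w; first by ring.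
  by rewrite e123 J145 (J124 3%N) //; ring.
by rewrite e mulr0 eqxx.
Qed.

(** Only the vectors 1, 2, 5 still have non-zero brackets. The rows of [M] are the brackets of the
    pairs 25, 51, 12, and its columns the coordinates 6, 4, 3. *)
Lemma lie_iso_two_step_form : exists (M : 'M[R]_3) (mu : 'cV[R]_3),
  lie_iso c (sc_two_step M) /\ trace_skew M mu.
Proof.
have [[[e121 e141 e151 e241 e251] e451] [[e122 e142 e152 e242 e252] e452]
  [e245 e255 e455] [e244 e243 e454 e453]] := g_zero.
have [[e125 e143 e144 e145 e155] [e236 e246 e346 e356 e456]] := g_center.
have e140 : g 1 4 0 = 0 by rewrite lam_g e141 e142 e143 e144 e145; ring.
have e240 : g 2 4 0 = 0 by rewrite lam_g e241 e242 e243 e244 e245; ring.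
have e450 : g 4 5 0 = 0 by rewrite lam_g e451 e452 e453 e454 e455; ring.
have e120 : g 1 2 0 = - (l 3 * g 1 2 3 + l 4 * g 1 2 4).
  by rewrite lam_g e121 e122 e125; ring.
have e150 : g 1 5 0 = - (l 3 * g 1 5 3 + l 4 * g 1 5 4).
  by rewrite lam_g e151 e152 e155; ring.
have e250 : g 2 5 0 = - (l 3 * g 2 5 3 + l 4 * g 2 5 4).
  by rewrite lam_g e251 e252 e255; ring.
have e146 : g 1 4 6 = 0 by d3_at 1%N 2%N 3%N 4%N; lra.
have e136 : g 1 3 6 = 0 by d3_at 1%N 3%N 4%N 5%N; lra.
pose M := mx3 [:: [:: g 2 5 6; g 2 5 4; g 2 5 3]; [:: - g 1 5 6; - g 1 5 4; - g 1 5 3];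
  [:: g 1 2 6; g 1 2 4; g 1 2 3]].
(* The last new coordinate agrees with [lam] on vectors whose coordinates 1, 2, 5 vanish, so it
   kills all brackets. *)
pose T := mx7 [:: [:: 0; 1]; [:: 0; 0; 1]; [:: 0; 0; 0; 0; 0; 1];
  [:: 0; 0; 0; 0; 0; 0; 1]; [:: 0; 0; 0; 0; 1]; [:: 0; 0; 0; 1];
  [:: 1; 0; 0; l 3; l 4]].
have TE x : [/\ (x *m T)`[0] = x`[1], (x *m T)`[1] = x`[2],
   (x *m T)`[2] = x`[5] & (x *m T)`[3] = x`[6]] /\
   [/\ (x *m T)`[4] = x`[4], (x *m T)`[5] = x`[3] &
   (x *m T)`[6] = x`[0] + l 3 * x`[3] + l 4 * x`[4]].
  by split; split; rewrite mul_mx7 //=; ring.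
(* The vector mu lists the values of [lam] on the vectors 6, 4, 3. *)
exists M, (\col_i nth 0 [:: 0; l 4; l 3] i); split.
  exists T; split=> [|x y].
    apply: unitmx_ker => x x0; have [[]] := TE x; rewrite x0 !mxE => e1 e2 e5 e6 [e4 e3].
    rewrite -e4 -e3 !mulr0 !addr0 => e0.
    by apply: rV7P; rewrite -?(e0, e1, e2, e3, e4, e5, e6) !mxE.
  rewrite lbr_two_step; have [[k0 k1 k2 k3] [k4 k5 k6]] := TE (lbr c x y).
  have [[x0 x1 x2 x3] [x4 x5 x6]] := TE x; have [[y0 y1 y2 y3] [y4 y5 y6]] := TE y.
  apply: rV7P; rewrite two_step_coord //= ?(k0, k1, k2, k3, k4, k5, k6) !lbr_coord
    ?g3_zero ?(e120, e150, e250).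
  - by rewrite e121 e141 e151 e241 e251 e451; ring.
  - by rewrite e122 e142 e152 e242 e252 e452; ring.
  - by rewrite e125 e145 e155 e245 e255 e455; ring.
  - rewrite e136 e146 e236 e246 e346 e356 e456 /minor2 x0 x1 x2 y0 y1 y2 !mxE !inordK //=; ring.
  - rewrite e144 e244 e454 /minor2 x0 x1 x2 y0 y1 y2 !mxE !inordK //=; ring.
  - rewrite e143 e243 e453 /minor2 x0 x1 x2 y0 y1 y2 !mxE !inordK //=; ring.
  - by rewrite e140 e143 e144 e240 e243 e244 e450 e453 e454; ring.
rewrite /trace_skew !mxE !big_o3 !mxE !inordK //=; split.
(* The first equation is the trace; in the other three the coordinate 0 of a bracket enters and
   supplies the entries of [M *m mu]. *)
- by d3_at 0%N 1%N 2%N 5%N; lra.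
- by d3_at 1%N 2%N 3%N 5%N; rewrite e120; lra.
- by d3_at 1%N 2%N 4%N 5%N; rewrite e150; lra.
- by d3_at 1%N 2%N 5%N 6%N; rewrite e250; lra.
Qed.

End StructureConstants.

(* If M = u v^T then M - M^T = [u x v]_x, so the skew equations read
   u x v = - (v . mu) u; as u x v is orthogonal to u this forces u x v = 0, and
   together with u . v = 0 this gives |u|^2 |v|^2 = 0. *)
Lemma trace_skew_rank_le1 (R : realFieldType) (M : 'M[R]_3) (mu : 'cV[R]_3) :
  trace_skew M mu -> (\rank M <= 1)%N -> M = 0.
Proof.
case: (posnP (\rank M)) => [r0|r0] h r1.
  by apply/eqP; rewrite -mxrank_eq0 r0.
have r : \rank M = 1 by apply/eqP; rewrite eqn_leq r1.
have [u [v e]] : exists (u : 'cV_3) (v : 'rV_3), M = u *m v.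
  have := mulmx_base M; move: (col_base M) (row_base M); rewrite r => u v <-.
  by exists u, v.
have mE i j : M i j = u i 0 * v 0 j by rewrite e mxE big_ord1.
move: h; rewrite /trace_skew !mxE !big_o3 !mE; clear mE.
pose a (i : nat) := u (o3 i) 0; pose b (i : nat) := v 0 (o3 i).
pose k := b 0%N * mu (o3 0) 0 + b 1%N * mu (o3 1) 0 + b 2%N * mu (o3 2) 0.
rewrite -/(a 0%N) -/(a 1%N) -/(a 2%N) -/(b 0%N) -/(b 1%N) -/(b 2%N) => -[tr h2 h1 h0].
have {}h2 : a 0%N * b 1%N - a 1%N * b 0%N = - k * a 2%N by rewrite h2 /k; ring.
have {}h1 : a 2%N * b 0%N - a 0%N * b 2%N = - k * a 1%N.
  by rewrite -opprB h1 /k; ring.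
have {}h0 : a 1%N * b 2%N - a 2%N * b 1%N = - k * a 0%N by rewrite h0 /k; ring.
have ka : k * (a 0%N ^+ 2 + a 1%N ^+ 2 + a 2%N ^+ 2) = 0.
  transitivity (- (a 0%N * (- k * a 0%N) + a 1%N * (- k * a 1%N)
    + a 2%N * (- k * a 2%N))); first by ring.
  by rewrite -h0 -h1 -h2; ring.
(* Lagrange's identity: |u|^2 |v|^2 = (u . v)^2 + |u x v|^2. *)
have ab : (a 0%N ^+ 2 + a 1%N ^+ 2 + a 2%N ^+ 2)
    * (b 0%N ^+ 2 + b 1%N ^+ 2 + b 2%N ^+ 2) = 0.
  transitivity ((a 0%N * b 0%N + a 1%N * b 1%N + a 2%N * b 2%N) ^+ 2
    + (a 1%N * b 2%N - a 2%N * b 1%N) ^+ 2 + (a 2%N * b 0%N - a 0%N * b 2%N) ^+ 2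
    + (a 0%N * b 1%N - a 1%N * b 0%N) ^+ 2); first by ring.
  rewrite tr h0 h1 h2.
  transitivity (k * (k * (a 0%N ^+ 2 + a 1%N ^+ 2 + a 2%N ^+ 2))); first by ring.
  by rewrite ka mulr0.
have sq0 (f : nat -> R) : f 0%N ^+ 2 + f 1%N ^+ 2 + f 2%N ^+ 2 = 0 ->
    forall i, (i < 3)%N -> f i = 0.
  move=> /eqP; rewrite !paddr_eq0 ?addr_ge0 ?sqr_ge0 // !sqrf_eq0.
  by case/andP=> /andP[/eqP f0 /eqP f1] /eqP f2 i; do 3?[case: i => [|i]].
rewrite e; move/eqP: ab; rewrite mulf_eq0 => /orP[]/eqP/sq0 z; apply: mx3P => i j i3 j3.
  by rewrite !mxE big_ord1 -/(a i) (z i) // mul0r.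
by rewrite !mxE big_ord1 -/(b j) (z j) // mulr0.
Qed.

(** * Ideals and central vectors *)

Section Nilpotent.
Variables (F : fieldType) (c : sconst F).

(** A bracket outside [N] is bracketed further for as long as the result stays outside [N];
    nilpotency stops this. [N] is kept general to serve both for zero and for the multiples of a
    fixed vector. *)
Lemma nilpotent_last_bracket (A N : 'rV[F]_7 -> Prop) x y :
  lie_nilpotent c -> (forall x y, A x -> A y -> A (lbr c x y)) -> N 0 ->
  A x -> A y -> ~ N (lbr c x y) ->
  exists u v, [/\ A u, A v, ~ N (lbr c u v) &
    forall z, A z -> N (lbr c z (lbr c u v))].
Proof.
case=> n nil Alie N0.
have : forall s, size s = n -> foldr (lbr c) (lbr c x y) s = 0 by move=> s; apply: nil.
elim: n x y {nil} => [|n IH] x y nil Ax Ay nN.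
  by case: nN; rewrite -[lbr c x y]/(foldr (lbr c) (lbr c x y) [::]) nil.
have [[z [Az nNz]]|h] := classic (exists z, A z /\ ~ N (lbr c z (lbr c x y))).
  apply: (IH z (lbr c x y)) => // [s sz|]; last exact: Alie.
  (* The new element [z] is innermost in the longer iterated bracket. *)
  by have := nil (rcons s z); rewrite size_rcons sz foldr_rcons; apply.
exists x, y; split=> // z Az; apply: NNPP => nNz.
by apply: h; exists z.
Qed.

End Nilpotent.

Lemma cap0_eq0 (F : fieldType) (n : nat) (A B : 'M[F]_n) (z : 'rV[F]_n) :
  (A :&: B == (0 : 'M[F]_n))%MS -> (z <= A)%MS -> (z <= B)%MS -> z = 0.
Proof.
case/andP=> AB0 _ zA zB; apply/eqP; rewrite -submx0.
by apply: submx_trans AB0; rewrite sub_capmx zA.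
Qed.

Lemma add1_decomp (F : fieldType) (n : nat) (A B : 'M[F]_n) (z : 'rV[F]_n) :
  (A + B == 1%:M)%MS ->
  exists a b : 'rV[F]_n, [/\ (a <= A)%MS, (b <= B)%MS & z = a + b].
Proof.
case/andP=> _ AB1; have : (z <= A + B)%MS by apply: submx_trans (submx1 z) AB1.
by case/sub_addsmxP=> -[u v] /= ->; exists (u *m A), (v *m B); rewrite !submxMl.
Qed.

(** * One of the two ideals is abelian *)

Section Decomposable.
Variables (R : rcfType) (c : sconst R) (P : 'M[R]_7).
Implicit Types (x y z : 'rV[R]_7).
Hypothesis lieP : is_lie c.
Hypothesis nilP : lie_nilpotent c.
Hypothesis uP : P \in unitmx.
Hypothesis closedP : forall x0 x1 x2 x3, d3 c (phiG2 P) x0 x1 x2 x3 = 0.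

Lemma phiG2_alt x y z : phiG2 P x y z = - phiG2 P y x z.
Proof. by rewrite !phiG2E /phi0 /det3; ring. Qed.

Lemma phiG2_0 y z : phiG2 P 0 y z = 0.
Proof. by rewrite !phiG2E /phi0 /det3 !mul0mx !mxE; ring. Qed.

Lemma phiG2_proportional x y : x != 0 -> (forall z, phiG2 P x y z = 0) ->
  exists a, y = a *: x.
Proof.
move=> x0 h; have [M [sM zM]] := stab_to6 (x *m P).
have uM := phi0_stab_unit sM; pose Q := P *m M.
have uQ : Q \in unitmx by rewrite unitmx_mul uP.
have xQ k : (k < 6)%N -> (x *m Q)`[k] = 0 by rewrite mulmxA; apply: zM.
have e k : phi0 (x *m Q) (y *m Q) (dl k) = 0.
  by rewrite -(mulmxKV uQ (dl k)) /Q !mulmxA sM -phiG2E h.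
have x6 : (x *m Q)`[6] != 0.
  apply: contra_neq x0 => x6; apply: (can_inj (mulmxK uQ)); rewrite mul0mx.
  by apply: rV7P; rewrite [RHS]mxE ?x6 ?xQ.
have yQ k : (k < 6)%N -> (y *m Q)`[k] = 0.
  move=> k6; apply: (mulfI x6); rewrite mulr0; move: k6.
  have [[x0' x1] [x2 x3]] := ((xQ 0 isT, xQ 1 isT), (xQ 2 isT, xQ 3 isT))%N.
  have [x4 x5] := (xQ 4 isT, xQ 5 isT)%N.
  do 6?[case: k => [|k]] => // _;
    [move: (e 1) | move: (e 0) | move: (e 3) | move: (e 2) | move: (e 5) | move: (e 4)];
    by rewrite /phi0 /det3 !dlE // x0' x1 x2 x3 x4 x5 /=; lra.
exists ((y *m Q)`[6] / (x *m Q)`[6]); apply: (can_inj (mulmxK uQ)).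
by rewrite -scalemxAl [X in _ = _ *: X](eq_dl6 xQ) scalerA divfK // -eq_dl6.
Qed.

Variables (A B : 'M[R]_7).
Hypothesis idA : lie_ideal c A.
Hypothesis idB : lie_ideal c B.
Hypothesis AB0 : (A :&: B == (0 : 'M[R]_7))%MS.
Hypothesis AB1 : (A + B == 1%:M)%MS.

Lemma lbr_cross x y : (x <= A)%MS -> (y <= B)%MS -> lbr c x y = 0.
Proof.
move=> xA yB; apply: (cap0_eq0 AB0); first exact: idA.
by rewrite (lbrC lieP) eqmx_opp; apply: idB.
Qed.

Lemma abelian_summand : (forall x y, (x <= A)%MS -> (y <= A)%MS -> lbr c x y = 0) \/
  (forall x y, (x <= B)%MS -> (y <= B)%MS -> lbr c x y = 0).
Proof.
apply: NNPP => /not_or_and[nA nB].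
have last (K : 'M[R]_7) : lie_ideal c K ->
    ~ (forall x y, (x <= K)%MS -> (y <= K)%MS -> lbr c x y = 0) ->
    exists u v, [/\ (u <= K)%MS, (v <= K)%MS, lbr c u v <> 0 &
      forall z, (z <= K)%MS -> lbr c z (lbr c u v) = 0].
  move=> idK nK; apply: NNPP => no; apply: nK => x y xK yK; apply: NNPP => nxy; apply: no.
  apply: (@nilpotent_last_bracket _ c (fun z => z <= K)%MS (eq^~ 0) x y) => //.
  by move=> u v uK _; apply: idK.
have [x1 [y1 [x1A y1A W0 WA]]] := last A idA nA.
have [x2 [y2 [x2B y2B S0 SB]]] := last B idB nB.
set W := lbr c x1 y1 in W0 WA; set S := lbr c x2 y2 in S0 SB.
have WinA : (W <= A)%MS by apply: idA.
have SinB : (S <= B)%MS by apply: idB.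
have Wc z : lbr c W z = 0.
  have [a [b [aA bB ->]]] := add1_decomp z AB1.
  by rewrite lbrDr (lbr_cross WinA bB) addr0 (lbrC lieP) WA ?oppr0.
have Sc z : lbr c S z = 0.
  have [a [b [aA bB ->]]] := add1_decomp z AB1.
  by rewrite lbrDr (lbrC lieP) (lbr_cross aA SinB) oppr0 add0r (lbrC lieP) SB ?oppr0.
(* As [W] is central and [a] commutes with [x2] and [y2], the only term of the differential left is
   the one with [S]. *)
have phiA a : (a <= A)%MS -> phiG2 P W S a = 0.
  move=> aA; have := closedP W x2 y2 a.
  rewrite /d3 !Wc !(lbrC lieP _ a) !(lbr_cross aA) // !oppr0 !phiG2_0 -/S.
  by rewrite (phiG2_alt S) !subr0 !add0r !addr0 => /eqP; rewrite oppr_eq0 => /eqP.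
have phiB b : (b <= B)%MS -> phiG2 P W S b = 0.
  move=> bB; have := closedP S x1 y1 b.
  rewrite /d3 !Sc !(lbr_cross _ bB) // !phiG2_0 -/W.
  by rewrite !subr0 !add0r !addr0.
have [|a eS] := @phiG2_proportional W S (introN eqP W0).
  move=> z; have [a [b [aA bB ->]]] := add1_decomp z AB1.
  have -> : phiG2 P W S (a + b) = phiG2 P W S a + phiG2 P W S b.
    by rewrite !phiG2E mulmxDl /phi0 /det3 !mxE; ring.
  by rewrite phiA // phiB // addr0.
by apply: S0; apply: (cap0_eq0 AB0) => //; rewrite eS scalemx_sub.
Qed.

End Decomposable.

(** * From a central vector outside the derived algebra to the matrix model *)

Section CentralSplitting.
Variables (R : rcfType) (c : sconst R) (P : 'M[R]_7).
Implicit Types (x y z : 'rV[R]_7).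
Hypothesis lieP : is_lie c.
Hypothesis nilP : lie_nilpotent c.
Hypothesis uP : P \in unitmx.
Hypothesis closedP : forall x0 x1 x2 x3, d3 c (phiG2 P) x0 x1 x2 x3 = 0.

Lemma closed_transport M : stab M ->
  forall x0 x1 x2 x3, d3 (transport c (P *m M)) (@phi0 R) x0 x1 x2 x3 = 0.
Proof.
move=> sM; have uQ : P *m M \in unitmx by rewrite unitmx_mul uP phi0_stab_unit.
have phiE x y z : phi0 (x *m (P *m M)) (y *m (P *m M)) (z *m (P *m M)) = phiG2 P x y z.
  by rewrite !mulmxA sM.
move=> x0 x1 x2 x3; rewrite -(mulmxKV uQ x0) -(mulmxKV uQ x1) -(mulmxKV uQ x2).
by rewrite -(mulmxKV uQ x3) /d3 !lbr_transport // !phiE; apply: closedP.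
Qed.

Lemma central_bracket : ~ (forall x y, lbr c x y = 0) ->
  exists x y, lbr c x y != 0 /\ forall z, lbr c (lbr c x y) z = 0.
Proof.
move=> nab; apply: NNPP => no; apply: nab => x y; apply: NNPP => nxy; apply: no.
have [u [v [_ _ /eqP n0 cen]]] := @nilpotent_last_bracket _ c (fun=> True)
  (fun z => z = 0) x y nilP (fun _ _ _ _ => I) erefl I I nxy.
by exists u, v; split=> // z; rewrite (lbrC lieP) cen ?oppr0.
Qed.

Lemma central_bracket_mod w : (forall z, lbr c w z = 0) ->
  (forall x y, exists a, lbr c x y = a *: w) \/
  exists x y, ~ (exists a, lbr c x y = a *: w) /\
    forall z, exists a, lbr c z (lbr c x y) = a *: w.
Proof.
move=> cw; apply: NNPP => /not_or_and[n1 n2]; apply: n1 => x y; apply: NNPP => nxy.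
have N0 : exists a, 0 = a *: w by exists 0; rewrite scale0r.
have [u [v [_ _ n0 cen]]] := @nilpotent_last_bracket _ c (fun=> True)
  (fun z => exists a, z = a *: w) x y nilP (fun _ _ _ _ => I) N0 I I nxy.
by apply: n2; exists u, v; split=> // z; apply: cen.
Qed.

Variables (e : 'rV[R]_7) (lam : 'cV[R]_7).
Hypothesis e_central : forall x, lbr c e x = 0.
Hypothesis lamP : forall x y, lbr c x y *m lam = 0.
Hypothesis lam_e : e *m lam = 1%:M.
Hypothesis nonabelian : ~ (forall x y, lbr c x y = 0).

Lemma calibrated_two_step : exists (M : 'M[R]_3) (mu : 'cV[R]_3),
  lie_iso c (sc_two_step M) /\ trace_skew M mu.
Proof.
have [x1 [y1 [w0 cw]]] := central_bracket nonabelian.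
set w := lbr c x1 y1 in w0 cw.
have lam_w : w *m lam = 0 by apply: lamP.
(* If all brackets are multiples of [w], then [v] is 0; otherwise it is a last bracket outside the
   line of [w]. *)
have [v [cv v_cases]] : exists v, (forall z, exists a, lbr c z v = a *: w) /\
    ((forall x y, exists a, lbr c x y = a *: w) \/
     (~ (exists a, v = a *: w)) /\ exists x y, v = lbr c x y).
  have [h|[x [y [nv cv]]]] := central_bracket_mod cw.
    by exists 0; split; [move=> z; exists 0; rewrite lbr0r scale0r | left].
  by exists (lbr c x y); split=> //; right; split=> //; exists x, y.
have [M [sM wM eM vM]] := adapted_frame (w *m P) (e *m P) (v *m P).
pose Q := P *m M; pose c' := transport c Q.
have uM := phi0_stab_unit sM.
have uQ : Q \in unitmx by rewrite unitmx_mul uP.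
have iso : lie_iso c c' by apply: lie_iso_transport.
have lie' := lie_iso_is_lie iso lieP; have nil' := lie_iso_nilpotent iso nilP.
have closed' := closed_transport sM; rewrite -/Q -/c' in closed'.
have brQ x y : lbr c' (x *m Q) (y *m Q) = lbr c x y *m Q by apply: lbr_transport.
rewrite -!(mulmxA _ P M) -/Q in wM eM vM.
have wE := eq_dl6 wM; set r := (w *m Q)`[6] in wE.
have r0 : r != 0.
  apply: contra_neq w0 => r0; apply: (can_inj (mulmxK uQ)).
  by rewrite wE r0 scale0r mul0mx.
have dl6E : dl 6 = r^-1 *: (w *m Q) by rewrite wE scalerA mulVf // scale1r.
pose s := (e *m Q)`[0].
have eE : e *m Q = s *: dl 0 + (e *m Q)`[6] *: dl 6.
  rewrite [LHS]row_sum_dl !(eM 1%N, eM 2%N, eM 3%N, eM 4%N, eM 5%N) //.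
  by rewrite !scale0r !addr0.
have lam_w' : (dl 6 : 'rV[R]_7) *m (invmx Q *m lam) = 0.
  by rewrite dl6E -scalemxAl mulmxA mulmxK // lam_w scaler0.
(* The functional separates [e] from [w], so [e] is no multiple of [w]. *)
have s0 : s != 0.
  apply/eqP => s0; have : e *m Q *m (invmx Q *m lam) = 0.
    by rewrite eE s0 scale0r add0r -scalemxAl lam_w' scaler0.
  rewrite mulmxA mulmxK // lam_e => /matrixP/(_ 0 0); rewrite !mxE => /eqP.
  by rewrite oner_eq0.
have dl0E : dl 0 = s^-1 *: (e *m Q - (e *m Q)`[6] *: dl 6).
  by rewrite {1}eE addrK scalerA mulVf // scale1r.
have center6 x : lbr c' (dl 6) x = 0.
  by rewrite dl6E -(mulmxKV uQ x) lbrZl brQ cw mul0mx scaler0.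
have center0 x : lbr c' (dl 0) x = 0.
  rewrite dl0E -(mulmxKV uQ x) lbrZl -scaleNr lbrDl brQ e_central mul0mx add0r.
  by rewrite lbrZl center6 !scaler0.
pose lam' := s *: (invmx Q *m lam).
have dl0_lam' : dl 0 *m lam' = 1%:M.
  rewrite -scalemxAr dl0E -scalemxAl mulmxBl -scalemxAl lam_w' scaler0 subr0.
  by rewrite mulmxA mulmxK // lam_e scalerA mulfV // scale1r.
have dl6_lam' : dl 6 *m lam' = 0 by rewrite -scalemxAr lam_w' scaler0.
have lam'0 : lam' (o7 0) 0 = 1.
  by move: dl0_lam'; rewrite -rowE => /matrixP/(_ 0 0); rewrite mxE => ->; rewrite mxE.
have lam'6 : lam' (o7 6) 0 = 0.
  by move: dl6_lam'; rewrite -rowE => /matrixP/(_ 0 0); rewrite mxE => ->; rewrite mxE.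
have lam'P x y : lbr c' x y *m lam' = 0.
  rewrite -(mulmxKV uQ x) -(mulmxKV uQ y) brQ -scalemxAr mulmxA mulmxK //.
  by rewrite lamP scaler0.
have coord1 x y : (lbr c' x y)`[1] = 0.
  have := closed' (dl 0) (dl 6) x y.
  rewrite /d3 !center0 !center6; set z := lbr c' x y.
  have phi00 u u' : phi0 (0 : 'rV[R]_7) u u' = 0 by rewrite /phi0 /det3 !mxE; ring.
  by rewrite !phi00 /phi0 /det3 !dlE //= => h; lra.
have smul_w a k : (k < 6)%N -> (a *: w *m Q)`[k] = 0.
  by move=> k6; rewrite -scalemxAl mxE wM // mulr0.
have brackets (k : nat) : (k < 6)%N -> (forall x y, exists a, lbr c x y = a *: w) ->
    forall x y, (lbr c' x y)`[k] = 0.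
  move=> k6 h x y; rewrite -(mulmxKV uQ x) -(mulmxKV uQ y) brQ.
  by have [a ->] := h (x *m invmx Q) (y *m invmx Q); apply: smul_w.
have vE : v *m Q = (v *m Q)`[0] *: dl 0 + (v *m Q)`[1] *: dl 1
    + (v *m Q)`[3] *: dl 3 + (v *m Q)`[6] *: dl 6.
  by rewrite [LHS]row_sum_dl !(vM 2%N, vM 4%N, vM 5%N) // !scale0r !addr0.
have v_case2 : ~ (exists a, v = a *: w) -> forall x y, v = lbr c x y ->
    (v *m Q)`[1] = 0 /\ (v *m Q)`[3] != 0.
  move=> nv x y ve; have v1 : (v *m Q)`[1] = 0 by rewrite ve -brQ coord1.
  split=> //; apply/eqP => v3; apply: nv.
  (* With the coordinates 1 and 3 gone, [lam'] reads off the coordinate 0 of the bracket [v], and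
     only a multiple of [w] would remain. *)
  have v0 : (v *m Q)`[0] = 0.
    have : v *m Q *m lam' = 0 by rewrite ve -brQ lam'P.
    rewrite {1}vE v1 v3 !scale0r !addr0 mulmxDl -!scalemxAl dl0_lam' dl6_lam'.
    move: (_`[0]) => t; rewrite scaler0 addr0 => /matrixP/(_ 0 0).
    by rewrite !mxE mulr1.
  exists ((v *m Q)`[6] * r^-1); apply: (can_inj (mulmxK uQ)).
  by rewrite [LHS]vE v0 v1 v3 !scale0r !add0r dl6E scalerA -scalemxAl.
(* The vector 3 is [v] up to a scalar and the central vectors 0 and 6, unless all brackets are
   multiples of [w]. *)
have center3 x k : (k < 6)%N -> (lbr c' x (dl 3))`[k] = 0.
  move=> k6; case: v_cases => [h|[nv [p [q ve]]]]; first exact: brackets.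
  have [v1 v3] := v_case2 nv p q ve.
  have dl3E : dl 3 = ((v *m Q)`[3])^-1 *:
      (v *m Q - (v *m Q)`[0] *: dl 0 - (v *m Q)`[6] *: dl 6).
    rewrite [X in _ *: (X - _ - _)]vE v1 scale0r addr0.
    rewrite [X in _ *: X]addrAC addrK [X in _ *: X]addrAC subrr add0r.
    by rewrite scalerA mulVf // scale1r.
  have cr u : lbr c' x (u *: dl 0) = 0 /\ lbr c' x (u *: dl 6) = 0.
    by rewrite !lbrZr !(lbrC lie' x) center0 center6 oppr0 scaler0.
  rewrite dl3E lbrZr -!scaleNr !lbrDr !(cr _).1 !(cr _).2 !addr0.
  rewrite -(mulmxKV uQ x) brQ mxE.
  by have [a ->] := cv (x *m invmx Q); rewrite smul_w // mulr0.
have bracket3 : (forall x y k, (k < 6)%N -> (lbr c' x y)`[k] = 0) \/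
    exists x y, (lbr c' x y)`[3] != 0 /\ (lbr c' x y)`[5] = 0.
  case: v_cases => [h|[nv [p [q ve]]]].
    by left=> x y k k6; apply: brackets.
  right; exists (p *m Q), (q *m Q); rewrite brQ -ve (vM 5%N) //.
  by have [_ ->] := v_case2 nv p q ve.
have [N [mu [iso' tsN]]] := lie_iso_two_step_form lie' nil' closed' center0 center6
  lam'0 lam'6 lam'P center3 bracket3.
by exists N, mu; split=> //; apply: lie_iso_trans iso iso'.
Qed.

Lemma calibrated_central_splitting : lie_iso c (lie_n1 R) \/ lie_iso c (lie_n2 R).
Proof.
have [M [mu [iso ts]]] := calibrated_two_step.
have [r1|r1] := leqP (\rank M) 1.
  (* Rank at most 1 forces the matrix to be 0, hence an abelian algebra. *)
  case: nonabelian => x y; have [L [uL hL]] := iso.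
  apply: (can_inj (mulmxK uL)); rewrite -hL lbr_two_step mul0mx.
  rewrite (trace_skew_rank_le1 ts r1).
  by apply: rV7P; rewrite two_step_coord // !mxE //= !mulr0 !addr0.
have r3 := rank_leq_row M.
have [e3|n3] := eqVneq (\rank M) 3.
  right; apply: lie_iso_trans iso _; apply: lie_iso_trans (lie_n2_two_step R).
  by apply: lie_iso_two_step_rank; rewrite e3 rank_mx_n2.
left; apply: lie_iso_trans iso _; apply: lie_iso_trans (lie_n1_two_step R).
apply: lie_iso_two_step_rank; rewrite rank_mx_n1; apply/eqP.
by rewrite eqn_leq r1 andbT -ltnS ltn_neqAle n3.
Qed.

End CentralSplitting.

(** * The separating functional and the classification *)

Lemma cap0_functional (F : fieldType) (n : nat) (A B : 'M[F]_n) :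
  A != 0 -> (A :&: B == (0 : 'M[F]_n))%MS ->
  exists (e : 'rV[F]_n) (lam : 'cV[F]_n), [/\ (e <= A)%MS, e *m lam = 1%:M &
    forall z : 'rV[F]_n, (z <= B)%MS -> z *m lam = 0].
Proof.
move=> A0 AB0; have [i ei] : exists i, row i A != 0.
  by apply/existsP; apply: contra_neqT A0; rewrite negb_exists => /forallP h;
     apply/row_matrixP => i; rewrite row0; apply/eqP; move: (h i); rewrite negbK.
have nB : ~~ (row i A <= B)%MS.
  by apply: contra_neqN ei; apply: (cap0_eq0 AB0); apply: row_sub.
(* The columns of [cokermx B] are functionals with common kernel [B], so one of them is non-zero on
   the chosen row of [A]. *)
have [j nj] : exists j, (row i A *m cokermx B) 0 j != 0.
  apply/existsP; apply: contraR nB; rewrite negb_exists => /forallP h.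
  rewrite submxE; apply/eqP/rowP => j; rewrite [RHS]mxE; apply/eqP.
  by move: (h j); rewrite negbK.
set K := cokermx B in nj; set t := (row i A *m K) 0 j in nj.
have colM z : z *m (t^-1 *: col j K) = t^-1 *: col j (z *m K).
  by rewrite -scalemxAr !colE mulmxA.
exists (row i A), (t^-1 *: col j K); split; first exact: row_sub.
- rewrite colM; apply/matrixP => k l.
  by rewrite !ord1 [LHS]mxE [col _ _ _ _]mxE mulVf // [RHS]mxE.
- by move=> z; rewrite submxE colM => /eqP ->; rewrite col0 scaler0.
Qed.

Unset Implicit Arguments.
Set Strict Implicit.

Theorem theorem3p1 (R : rcfType) (c : sconst R) :
  is_lie c -> lie_nilpotent c -> lie_decomposable c ->
  (has_calibrated_G2 c <->
     lie_iso c (lie_ab R) \/ lie_iso c (lie_n1 R) \/ lie_iso c (lie_n2 R)).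
Proof.
move=> lieP nilP [A [B [idA idB [A0 B0] AB0 AB1]]].
split=> [[P [uP cl]]|[iso|[iso|iso]]]; last 3 first.
- exact: lie_iso_calibrated iso (calibrated_ab R).
- exact: lie_iso_calibrated iso (calibrated_n1 R).
- by apply: lie_iso_calibrated iso (calibrated_n2 _); rewrite pnatr_eq0.
have [ab|nab] := classic (forall x y, lbr c x y = 0).
  left; apply: lie_iso_eq => x y; rewrite ab.
  by apply: rV7P; rewrite lbr_mk_sc // big_nil mxE.
right.
(* The two ideals play symmetric roles, so the abelian one may be called [A]. *)
wlog abA : A B idA idB A0 B0 AB0 AB1 /
    forall x y, (x <= A)%MS -> (y <= A)%MS -> lbr c x y = 0.
  move=> wl; case: (abelian_summand lieP nilP uP cl idA idB AB0 AB1) => h.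
    exact: (wl A B).
  by apply: (wl B A) => //; rewrite 1?capmxC 1?addsmxC.
have [e [lam [eA lam_e lamB]]] := cap0_functional A0 AB0.
have e_central x : lbr c e x = 0.
  have [a [b [aA bB ->]]] := add1_decomp x AB1.
  by rewrite lbrDr abA // (lbr_cross lieP idA idB AB0 eA bB) addr0.
have lamP x y : lbr c x y *m lam = 0.
  have [a [b [aA bB ->]]] := add1_decomp x AB1.
  have [a' [b' [aA' bB' ->]]] := add1_decomp y AB1.
  rewrite lbrDl !lbrDr abA // (lbr_cross lieP idA idB AB0 aA bB') (lbrC lieP b).
  rewrite (lbr_cross lieP idA idB AB0 aA' bB) oppr0 !add0r.
  (* Only the bracket of the two components in [B] survives, and it lies in [B]. *)
  by apply: lamB; apply: idB.
exact: (calibrated_central_splitting lieP nilP uP cl e_central lamP lam_e nab).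
Qed.
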